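(* For every index $\mathbf{k}\in I$, we have \[ \zeta_{x,y}^{\text{ш}}(\mathbf{k};T)=\rho_{x,y}(\zeta_{x,y}^{*}(\mathbf{k};T)). \]
   Context: An index is a finite (possibly empty) sequence of positive integers; $I$ denotes the set of all indices. An index is admissible if it is empty or its first component is greater than $1$. For admissible $\mathbf{k}=(k_1,\dots,k_r)$, $\zeta(\mathbf{k})=\sum_{m_1>\dots>m_r\ge1}m_1^{-k_1}\dotsm m_r^{-k_r}$ (with $\zeta(\emptyset)=1$). Functions on $I$ are extended $\mathbb{Q}$-linearly to the $\mathbb{Q}$-span of $I$. On this span there are two $\mathbb{Q}$-bilinear products: the harmonic (stuffle) product $*$ and the shuffle product $\text{ш}$ (the latter obtained by encoding $(k_1,\dots,k_r)$ as the word $0^{k_1-1}1\cdots0^{k_r-1}1$ and summing over all interleavings). For $\bullet\in\{*,\text{ш}\}$, $\zeta^{\bullet}(\mathbf{k};T)\in\mathbb{R}[T]$ denotes the regularization of Ihara–Kaneko–Zagier, uniquely determined by: $\zeta^{\bullet}(\mathbf{k};T)=\zeta(\mathbf{k})$ for admissible $\mathbf{k}$; $\zeta^{\bullet}(1;T)=T$; and $\zeta^{*}(\mathbf{k};T)\zeta^{*}(\mathbf{l};T)=\zeta^{*}(\mathbf{k}*\mathbf{l};T)$, $\zeta^{\text{ш}}(\mathbf{k};T)\zeta^{\text{ш}}(\mathbf{l};T)=\zeta^{\text{ш}}(\mathbf{k}\,\text{ш}\,\mathbf{l};T)$ for all $\mathbf{k},\mathbf{l}\in I$. For $\mathbf{k}=(k_1,\dots,k_r)\in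 I$ and $\bullet\in\{*,\text{ш}\}$, \[ \zeta_{x,y}^{\bullet}(\mathbf{k};T)=\sum_{i=0}^{r}x^{k_1+\dots+k_i}y^{k_{i+1}+\dots+k_r}\zeta^{\bullet}(k_i,\dots,k_1;T)\zeta^{\bullet}(k_{i+1},\dots,k_r;T)\in\mathbb{R}[x,y,T], \] with $\zeta_{x,y}^{\bullet}(\emptyset;T)=1$. Set $A_{x,y}(u)=\exp\bigl(\sum_{n=2}^{\infty}\frac{(-1)^n}{n}\zeta(n)\frac{x^n+y^n}{(x+y)^n}u^n\bigr)\in\mathbb{R}(x,y)[[u]]$, and let $\rho_{x,y}\colon\mathbb{R}(x,y)[T]\to\mathbb{R}(x,y)[T]$ be the $\mathbb{R}(x,y)$-linear map defined by $\rho_{x,y}(e^{Tu})=A_{x,y}(u)e^{Tu}$ in $\mathbb{R}(x,y)[T][[u]]$, with $\rho_{x,y}$ acting coefficientwise. *)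

(* Defs.v *)
From HB Require Import structures.
From mathcomp Require Import all_boot all_order all_algebra.
From mathcomp Require Import all_classical all_reals all_analysis.

Set Implicit Arguments.
Unset Strict Implicit.
Unset Printing Implicit Defensive.

Import Order.TTheory GRing.Theory Num.Theory.

Local Open Scope ring_scope.

(* An index is a [seq nat] satisfying [is_index]; functions on indices are
   total functions on [seq nat] whose values elsewhere are irrelevant. *)
Definition is_index (k : seq nat) : bool := all (fun n => 0 < n)%N k.

Definition admissible (k : seq nat) : bool :=
  if k is k1 :: _ then (1 < k1)%N else true.

(* The harmonic and shuffle products of two indices are combinations of indices
   with coefficients in nat: such a combination is represented by the list of
   its indices, each one repeated as many times as its coefficient, so that the
   linear extension of f takes the value \sum_(m <- s) f m at s. *)
Fixpoint stuffle (k : seq nat) : seq nat -> seq (seq nat) :=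
  fix stuffle_k (l : seq nat) : seq (seq nat) :=
    match k, l with
    | [::], _ => [:: l]
    | _, [::] => [:: k]
    | a :: k', b :: l' =>
        [seq a :: m | m <- stuffle k' l] ++
        [seq b :: m | m <- stuffle_k l'] ++
        [seq (a + b)%N :: m | m <- stuffle k' l']
    end.

(* The letters 0 and 1 are [false] and [true]. *)
Definition word_of_index (k : seq nat) : seq bool :=
  flatten [seq rcons (nseq n.-1 false) true | n <- k].

Fixpoint index_of_word_rec (n : nat) (w : seq bool) : seq nat :=
  match w with
  | [::] => [::]
  | false :: w' => index_of_word_rec n.+1 w'
  | true :: w' => n.+1 :: index_of_word_rec 0 w'
  end.

Definition index_of_word (w : seq bool) : seq nat := index_of_word_rec 0 w.

Lemma word_of_indexK (k : seq nat) :
  is_index k -> index_of_word (word_of_index k) = k.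
Proof.
rewrite /index_of_word /word_of_index.
elim: k => [//|[//|n] k IH] /= /IH {}IH.
have H m s : index_of_word_rec m (rcons (nseq n false) true ++ s) =
    (m + n).+1 :: index_of_word_rec 0 s.
  by elim: n m => [|n IHn] m /=; rewrite ?addn0 // IHn addSnnS.
by rewrite H IH.
Qed.

Fixpoint interleavings (u : seq bool) : seq bool -> seq (seq bool) :=
  fix interleavings_u (v : seq bool) : seq (seq bool) :=
    match u, v with
    | [::], _ => [:: v]
    | _, [::] => [:: u]
    | a :: u', b :: v' =>
        [seq a :: w | w <- interleavings u' v] ++
        [seq b :: w | w <- interleavings_u v']
    end.

Definition shuffle (k l : seq nat) : seq (seq nat) :=
  [seq index_of_word w | w <- interleavings (word_of_index k) (word_of_index l)].

Section MultipleZeta.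
Variable R : realType.

Definition mzv_domain (r : nat) : set (seq nat) :=
  [set m | size m = r /\ sorted gtn m && all (fun n => 0 < n)%N m].

Definition mzv_term (k m : seq nat) : R :=
  \prod_(p <- zip m k) (p.1%:R ^- p.2).

Definition mzv (k : seq nat) : R :=
  fine (\esum_(m in mzv_domain (size k)) (mzv_term k m)%:E).

Record is_regularization (prod : seq nat -> seq nat -> seq (seq nat))
    (f : seq nat -> {poly R}) : Prop := IsRegularization {
  reg_admissible : forall k, is_index k -> admissible k -> f k = (mzv k)%:P;
  reg_one : f [:: 1%N] = 'X;
  reg_prod : forall k l, is_index k -> is_index l ->
    f k * f l = \sum_(m <- prod k l) f m }.

(* The properties above determine the values at all indices when [prod] is
   [stuffle] or [shuffle]. The default value 0 of [xget] would only be used if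
   no regularization existed. *)
Definition regularization (prod : seq nat -> seq nat -> seq (seq nat)) :
    seq nat -> {poly R} :=
  xget (fun=> 0) [set f | is_regularization prod f].

Definition zeta_st : seq nat -> {poly R} := regularization stuffle.
Definition zeta_sh : seq nat -> {poly R} := regularization shuffle.

(* R[x, y] *)
Definition Rxy := {poly {poly R}}.
Definition vx : Rxy := 'X%:P.
Definition vy : Rxy := 'X.

(* R[T] -> R[x, y][T] *)
Definition toRxyT (p : {poly R}) : {poly Rxy} := map_poly (fun c => c%:P%:P) p.

Definition zeta_xy (z : seq nat -> {poly R}) (k : seq nat) : {poly Rxy} :=
  \sum_(i < (size k).+1)
    (vx ^+ sumn (take i k) * vy ^+ sumn (drop i k)) *:
    (toRxyT (z (rev (take i k))) * toRxyT (z (drop i k))).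

End MultipleZeta.

(* A formal power series over A is the function nat -> A of its coefficients. *)
Section FormalPowerSeries.

Definition fps_one (A : nzRingType) : nat -> A := fun n => (n == 0%N)%:R.

Definition fps_mul (A : nzRingType) (a b : nat -> A) : nat -> A :=
  fun n => \sum_(i < n.+1) a i * b (n - i)%N.

Definition fps_pow (A : nzRingType) (a : nat -> A) (j : nat) : nat -> A :=
  iter j (fps_mul a) (fps_one A).

(* For a series a with zero constant term: the terms a ^ j / j! with j > n do
   not contribute to the coefficient of degree n of exp(a). *)
Definition fps_exp (F : fieldType) (a : nat -> F) : nat -> F :=
  fun n => \sum_(j < n.+1) fps_pow a j n / (j`!)%:R.

End FormalPowerSeries.

Section Rho.
Variable R : realType.

(* R(x, y) *)
Definition Kxy := {fraction (Rxy R)}.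

Definition toKxy (p : Rxy R) : Kxy := @FracField.tofrac (Rxy R) p.

Definition fx : Kxy := toKxy (vx R).
Definition fy : Kxy := toKxy (vy R).

Definition A_exponent (n : nat) : Kxy :=
  if (n < 2)%N then 0
  else (-1) ^+ n / n%:R * toKxy (mzv R [:: n])%:P%:P
       * ((fx ^+ n + fy ^+ n) / (fx + fy) ^+ n).

Definition A_xy : nat -> Kxy := fps_exp A_exponent.

(* e^(Tu), as a series in u over R(x, y)[T] *)
Definition expTu (n : nat) : {poly Kxy} := ((n`!)%:R)^-1 *: 'X^n.

(* The linear map such that rho_xy 'X^n is n! times the coefficient of u^n in
   A_xy(u) e^(Tu); see rho_xy_expTu. *)
Definition rho_xy (p : {poly Kxy}) : {poly Kxy} :=
  \sum_(n < size p)
    (p`_n * (n`!)%:R) *: fps_mul (fun i => (A_xy i)%:P) expTu n.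

Lemma rho_xy_widen (N : nat) (p : {poly Kxy}) : (size p <= N)%N ->
  rho_xy p = \sum_(n < N)
    (p`_n * (n`!)%:R) *: fps_mul (fun i => (A_xy i)%:P) expTu n.
Proof.
move=> leN; rewrite /rho_xy.
rewrite (big_ord_widen N (fun n =>
  (p`_n * (n`!)%:R) *: fps_mul (fun i => (A_xy i)%:P) expTu n)) //.
rewrite big_mkcond; apply: eq_bigr => i _.
by case: ltnP => // le; rewrite nth_default // mul0r scale0r.
Qed.

Lemma rho_xy_is_linear : linear rho_xy.
Proof.
move=> a p q; pose N := maxn (size (a *: p + q)) (maxn (size p) (size q)).
rewrite !(@rho_xy_widen N) ?leq_max ?leqnn ?orbT //.
rewrite scaler_sumr -big_split; apply: eq_bigr => i _ /=.
by rewrite coefD coefZ scalerA -scalerDl mulrDl mulrA.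
Qed.

HB.instance Definition _ :=
  GRing.isLinear.Build Kxy {poly Kxy} {poly Kxy} _ rho_xy rho_xy_is_linear.

Lemma Kxy_natr_neq0 (n : nat) : (0 < n)%N -> n%:R != 0 :> Kxy.
Proof.
move=> n_gt0; rewrite -(rmorph_nat (@FracField.tofrac (Rxy R))).
by rewrite tofrac_eq0 -!polyC_natr !polyC_eq0 pnatr_eq0 -lt0n.
Qed.

Lemma rho_xy_expTu (n : nat) :
  rho_xy (expTu n) = fps_mul (fun i => (A_xy i)%:P) expTu n.
Proof.
have nf : (n`!)%:R != 0 :> Kxy by rewrite Kxy_natr_neq0 ?fact_gt0.
rewrite {1}/expTu linearZ /= (@rho_xy_widen n.+1) ?size_polyXn //.
rewrite big_ord_recr big1 /=; last first.
  by move=> i _; rewrite coefXn (ltn_eqF (ltn_ord i)) mul0r scale0r.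
by rewrite add0r coefXn eqxx mul1r scalerA mulVf // scale1r.
Qed.

(* R[x, y][T] -> R(x, y)[T] *)
Definition toKxyT (p : {poly Rxy R}) : {poly Kxy} := map_poly toKxy p.

End Rho.

(* Main.v *)
(* With e_j(m) the j-th elementary symmetric function of 1, 1/2, ..., 1/m, every
   truncated sum zeta_m(k) equals \sum_j d_j(k) e_j(m) up to an error
   O((log m)^J / m): if zeta_m(k) has such an expansion, summing it against 1/m
   gives one for (1, k) with the d_j shifted by one and a new constant term, and
   admissible indices converge.  The polynomials \sum_j d_j(k) T^j / j! are the
   shuffle regularization: the coefficients of the polylogarithms multiply by
   the shuffle rule under the Cauchy product, and the Cauchy product of those
   of Li_{1^i} and Li_{1^j} is 'C(i + j, i) times those of Li_{1^(i+j)}.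
   Newton's identities turn e_j(m) into Q_j(H_m), with H_m the harmonic number
   and \sum_j Q_j(T) u^j = e^(Tu) / A(u), where
   A(u) = exp(\sum_(n >= 2) (-1)^n / n zeta(n) u^n); so the polynomials
   \sum_j d_j(k) Q_j(T) are the harmonic regularization, since truncated sums
   multiply by the stuffle rule.
   As d_j(k) only depends on k with j leading ones removed, zeta_{x,y}(k) is a
   combination, over the runs of ones k_(a+1) = ... = k_b = 1 and with
   coefficients common to both products, of the coefficients of u^(b-a) in
   e^(T(x+y)u) for the shuffle and e^(T(x+y)u) / (A(xu) A(yu)) for the stuffle.
   Since A_{x,y}((x+y)u) = A(xu) A(yu), rho_{x,y} maps the latter to the
   former. *)
From HB Require Import structures.
From mathcomp Require Import all_boot all_order all_algebra.
From mathcomp Require Import all_classical all_reals all_analysis.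
From mathcomp Require Import polyrcf ring lra zify.
Require Import Defs.

Set Implicit Arguments.
Unset Strict Implicit.
Unset Printing Implicit Defensive.

Import Order.TTheory GRing.Theory Num.Theory.
Import numFieldNormedType.Exports.

Local Open Scope ring_scope.

(** * Formal power series *)

Section FormalSeries.
Variable A : comNzRingType.
Implicit Types a b c : nat -> A.

(** Truncation to polynomials lets the product of series inherit commutativity and associativity
    from the polynomial ring. *)
Lemma fps_mul_coef N a b n : (n < N)%N ->
  fps_mul a b n = ((\poly_(i < N) a i) * (\poly_(i < N) b i))`_n.
Proof.
move=> nN; rewrite coefM; apply: eq_bigr => i _.
rewrite !coef_poly (leq_ltn_trans (leq_subr _ _) nN).
by rewrite (leq_trans (ltn_ord i) nN).
Qed.

Lemma fps_mulC a b : fps_mul a b = fps_mul b a.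
Proof.
by apply/funext => n; rewrite !(@fps_mul_coef n.+1) // mulrC.
Qed.

Lemma fps_mulA a b c : fps_mul a (fps_mul b c) = fps_mul (fps_mul a b) c.
Proof.
apply/funext => n; pose p a := \poly_(i < n.+1) a i.
transitivity ((p a * (p b * p c))`_n).
  rewrite coefM; apply: eq_bigr => i _.
  rewrite coef_poly ltn_ord (@fps_mul_coef n.+1) //.
  by rewrite ltnS leq_subr.
rewrite mulrA coefM; apply: eq_bigr => i _.
by rewrite (@fps_mul_coef n.+1) // coef_poly ltnS leq_subr.
Qed.

Lemma fps_mul1 a : fps_mul (fps_one A) a = a.
Proof.
apply/funext => n; rewrite /fps_mul big_ord_recl /fps_one /= mul1r subn0.
by rewrite big1 ?addr0 // => i _; rewrite mul0r.
Qed.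

Lemma fps_mulDl a b c :
  fps_mul (fun n => a n + b n) c = fun n => fps_mul a c n + fps_mul b c n.
Proof.
apply/funext => n; rewrite -big_split; apply: eq_bigr => i _ /=.
by rewrite mulrDl.
Qed.

Lemma fps_mulNl a b : fps_mul (fun n => - a n) b = fun n => - fps_mul a b n.
Proof.
apply/funext => n; rewrite -sumrN; apply: eq_bigr => i _ /=.
by rewrite mulNr.
Qed.

(** The Euler operator u d/du. It is a derivation and, in characteristic zero, determines a series
    up to its constant term, so that identities between series are proved by comparing these two. *)
Definition fps_theta a : nat -> A := fun n => a n *+ n.

Lemma fps_theta_mul a b : fps_theta (fps_mul a b) =
  fun n => fps_mul (fps_theta a) b n + fps_mul a (fps_theta b) n.
Proof.
apply/funext => n; rewrite /fps_theta -sumrMnl -big_split.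
apply: eq_bigr => i _ /=.
rewrite mulrnAl mulrnAr -mulrnDr; congr (_ *+ _).
by rewrite subnKC // leq_ord.
Qed.

Definition fps_scale (x : A) a : nat -> A := fun n => x ^+ n * a n.

Lemma fps_scale_mul x a b :
  fps_scale x (fps_mul a b) = fps_mul (fps_scale x a) (fps_scale x b).
Proof.
apply/funext => n; rewrite /fps_scale mulr_sumr; apply: eq_bigr => i _.
by rewrite mulrACA -exprD subnKC ?leq_ord.
Qed.

Lemma fps_theta_scale x a :
  fps_theta (fps_scale x a) = fps_scale x (fps_theta a).
Proof. by apply/funext => n; rewrite /fps_theta /fps_scale mulrnAr. Qed.

Lemma fps_pow_eq0 a j n : a 0%N = 0 -> (n < j)%N -> fps_pow a j n = 0.
Proof.
move=> a0; elim: j n => [//|j IH] n nj; rewrite /fps_pow iterS -/(fps_pow a j).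
apply: big1 => -[[|i] /= lti] _; first by rewrite a0 mul0r.
by rewrite IH ?mulr0 //; lia.
Qed.

Lemma fps_theta_pow a j :
  fps_theta (fps_pow a j.+1) =
    fun n => fps_mul (fps_theta a) (fps_pow a j) n *+ j.+1.
Proof.
elim: j => [|j IH].
  rewrite /fps_pow /= fps_mulC fps_mul1 fps_mulC fps_mul1.
  by apply/funext => n; rewrite mulr1n.
rewrite {1}/fps_pow iterS -/(fps_pow a j.+1) fps_theta_mul IH.
apply/funext => n; rewrite [RHS]mulrS; congr (_ + _).
rewrite {2}/fps_pow iterS -/(fps_pow a j) (fps_mulC a (fps_pow _ _)) fps_mulA.
by rewrite fps_mulC {1}/fps_mul -sumrMnl; apply: eq_bigr => i _; rewrite mulrnAl.
Qed.

End FormalSeries.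

(** * The exponential of a power series *)

Section Exponential.
Variable F : fieldType.
Hypothesis F0 : forall n, (0 < n)%N -> n%:R != 0 :> F.

Lemma fps_expE N (a : nat -> F) n : a 0%N = 0 -> (n < N)%N ->
  fps_exp a n = \sum_(j < N) fps_pow a j n / (j`!)%:R.
Proof.
move=> a0 nN; rewrite /fps_exp.
rewrite (big_ord_widen N (fun j => fps_pow a j n / (j`!)%:R)) //.
rewrite big_mkcond; apply: eq_bigr => i _; case: ltnP => // ni.
by rewrite fps_pow_eq0 // mul0r.
Qed.

Lemma fps_exp0 (a : nat -> F) : fps_exp a 0 = 1.
Proof. by rewrite /fps_exp big_ord1 /= divr1. Qed.

Lemma fps_theta_exp (a : nat -> F) : a 0%N = 0 ->
  fps_theta (fps_exp a) = fps_mul (fps_theta a) (fps_exp a).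
Proof.
move=> a0; apply/funext => n.
(* One term beyond degree n is kept: dropping j = 0, which [fps_theta] kills, leaves n.+1 terms,
   enough for all the coefficients of degree n - i. *)
rewrite /fps_theta (@fps_expE n.+2) // big_ord_recl.
transitivity (\sum_(j < n.+1)
    fps_mul (fps_theta a) (fps_pow a j) n / (j`!)%:R).
  rewrite mulrnDl /= {1}/fps_pow /= /fps_one.
  have -> : ((n == 0%N)%:R / 0`!%:R *+ n : F) = 0.
    by case: n => [|n] //=; rewrite mul0r mul0rn.
  rewrite add0r -sumrMnl; apply: eq_bigr => j _.
  rewrite /bump leq0n add1n -mulrnAl -/(fps_theta (fps_pow a j.+1) n) fps_theta_pow.
  rewrite factS natrM -[_ *+ j.+1]mulr_natr.
  by rewrite invfM mulrA mulfK ?F0.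
rewrite (eq_bigr (fun j : 'I_n.+1 => \sum_(i < n.+1)
   fps_theta a i * (fps_pow a j (n - i) / (j`!)%:R))); last first.
  by move=> j _; rewrite mulr_suml; apply: eq_bigr => i _; rewrite mulrA.
rewrite exchange_big; apply: eq_bigr => i _ /=.
by rewrite -mulr_sumr -fps_expE // ltnS leq_subr.
Qed.

Lemma fps_theta_eq0 (a : nat -> F) : a 0%N = 1 -> fps_theta a = (fun=> 0) ->
  a = fps_one F.
Proof.
move=> a0 ta; apply/funext => -[//|n]; apply/eqP.
have /(congr1 (fun f => f n.+1)) := ta; rewrite /fps_theta -mulr_natr => /eqP.
by rewrite mulf_eq0 (negPf (F0 _)) // orbF.
Qed.

End Exponential.

(** * Stuffle and shuffle products of indices *)

Section Products.

Lemma stuffle0l l : stuffle [::] l = [:: l]. Proof. by case: l. Qed.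

Lemma stuffle0r k : stuffle k [::] = [:: k]. Proof. by case: k. Qed.

Lemma stuffle_cons a k b l : stuffle (a :: k) (b :: l) =
  [seq a :: m | m <- stuffle k (b :: l)] ++
  [seq b :: m | m <- stuffle (a :: k) l] ++
  [seq (a + b)%N :: m | m <- stuffle k l].
Proof. by []. Qed.

Lemma interleavings0l v : interleavings [::] v = [:: v].
Proof. by case: v. Qed.

Lemma interleavings0r u : interleavings u [::] = [:: u].
Proof. by case: u. Qed.

Lemma interleavings_cons a u b v : interleavings (a :: u) (b :: v) =
  [seq a :: w | w <- interleavings u (b :: v)] ++
  [seq b :: w | w <- interleavings (a :: u) v].
Proof. by []. Qed.

Lemma is_index_stuffle k l : is_index k -> is_index l ->
  all is_index (stuffle k l).
Proof.
elim: k l => [|a k IHk] l; first by rewrite stuffle0l /= andbT.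
elim: l => [|b l IHl]; first by rewrite stuffle0r /= => ->.
move=> /[dup] ik /= /andP[a0 ik'] /[dup] il /= /andP[b0 il'].
rewrite !all_cat !all_map; apply/and3P; split; apply/allP => m /=.
- by move/(allP (IHk (b :: l) ik' il)) => im; apply/andP.
- by move/(allP (IHl ik il')) => im; apply/andP.
- by move/(allP (IHk _ ik' il')) => im; rewrite addn_gt0 a0.
Qed.

Lemma is_index_index_of_word w : is_index (index_of_word w).
Proof.
rewrite /index_of_word; elim: w 0%N => [//|[] w IH] n /=; last exact: IH.
exact: IH.
Qed.

Lemma is_index_shuffle k l : all is_index (shuffle k l).
Proof. by apply/allP => _ /mapP[w _ ->]; apply: is_index_index_of_word. Qed.

(** * Leading ones and uniqueness of regularizations *)

Definition leading_ones (k : seq nat) : nat := find (predC1 1%N) k.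

Definition leading_true (w : seq bool) : nat := find negb w.

(** The condition [last true w] selects the empty word and the words ending in 1, which are those
    that encode indices. *)
Lemma leading_ones_index_of_word w :
  last true w -> leading_ones (index_of_word w) = leading_true w.
Proof.
have H n v : leading_ones (index_of_word_rec n.+1 v) = 0%N.
  by elim: v n => [//|[] v IH] n //=; apply: IH.
by elim: w => [//|[] w IH] /= lw; rewrite ?H //=; congr _.+1; apply: IH.
Qed.

Lemma word_of_index1 k : word_of_index (1%N :: k) = true :: word_of_index k.
Proof. by []. Qed.

Lemma last_word_of_index k : last true (word_of_index k).
Proof.
rewrite /word_of_index; elim: k => [//|n k IH] /=.
rewrite last_cat last_rcons; exact: IH.
Qed.

Lemma last_interleavings u v : last true u -> last true v ->
  all (last true) (interleavings u v).
Proof.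
elim: u v => [|a u IHu] v; first by rewrite interleavings0l /= andbT.
elim: v => [|b v IHv]; first by rewrite interleavings0r /= => ->.
rewrite interleavings_cons => lu lv; rewrite all_cat !all_map.
(* An empty tail would make the prepended letter the last one, hence the check that no tail is
   empty. *)
have ne : {in interleavings u (b :: v), forall w, w != [::]}.
  move: lu lv => _ _; elim: u {IHu IHv} => [|c u _] w /=.
    by rewrite inE => /eqP->.
  by rewrite mem_cat => /orP[] /mapP[? _ ->].
have ne' : {in interleavings (a :: u) v, forall w, w != [::]}.
  move: lu lv => _ _; case: v {IHu IHv ne} => [|c v] w /=.
    by rewrite inE => /eqP->.
  by rewrite mem_cat => /orP[] /mapP[? _ ->].
have tl (c : bool) s : last true (c :: s) -> last true s by case: s.
have tl' (c : bool) s : s != [::] -> last true s -> last true (c :: s).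
  by case: s.
apply/andP; split; apply/allP => w wi /=; apply: tl'.
- exact: ne.
- exact: (allP (IHu _ (tl _ _ lu) lv)).
- exact: ne'.
- exact: (allP (IHv lu (tl _ _ lv))).
Qed.

(* The inductive step behind uniqueness: [1] times k' is a nonzero multiple of
   1 :: k' up to indices with fewer leading ones. *)
Definition leading_ones_triangular
    (prod : seq nat -> seq nat -> seq (seq nat)) :=
  forall k, is_index k -> exists2 s : seq (seq nat),
    all (fun m => is_index m && (leading_ones m <= leading_ones k)%N) s &
    perm_eq (prod [:: 1%N] k) (nseq (leading_ones k).+1 (1%N :: k) ++ s).

(** The new 1 has [leading_ones k] + 1 places in or next to the initial run of ones, each giving 1
    :: k; inserting it later or adding it to an entry never lengthens that run. *)
Lemma stuffle_triangular : leading_ones_triangular stuffle.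
Proof.
elim=> [|b k IH] ik; first by exists [::].
have [b0 ik'] : (0 < b)%N /\ is_index k by apply/andP.
have [s ss ps] := IH ik'.
rewrite stuffle_cons stuffle0l stuffle0l.
have [b1|b1] := eqVneq b 1%N.
  exists ([seq b :: m | m <- s] ++ [:: (1 + b)%N :: k]).
    rewrite all_cat all_map /= -/(is_index k).
    rewrite ik' b1 /=; apply/andP; split=> //.
  rewrite b1 -[leading_ones (1%N :: k)]/(leading_ones k).+1 /= perm_cons.
  rewrite -!cat_cons catA perm_cat2r.
  by rewrite (perm_trans (perm_map _ ps)) // map_cat map_nseq.
exists ([seq b :: m | m <- stuffle [:: 1%N] k] ++ [:: (1 + b)%N :: k]).
  rewrite all_cat all_map /= -/(is_index k).
  rewrite ik' /=; apply/andP; split; last first.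
    by rewrite /leading_ones /= add1n eqSS -lt0n b0.
  apply/allP => m mi /=; rewrite b0 /leading_ones /= b1 andbT.
  exact: (allP (@is_index_stuffle [:: 1%N] k isT ik') m mi).
by rewrite /= /leading_ones /= b1.
Qed.

Lemma interleavings_triangular w : exists2 s : seq (seq bool),
  all (fun v => leading_true v <= leading_true w)%N s &
  perm_eq (interleavings [:: true] w)
    (nseq (leading_true w).+1 (true :: w) ++ s).
Proof.
elim: w => [|[] w [s ss ps]]; first by exists [::].
  exists [seq true :: v | v <- s].
    by rewrite all_map; apply/allP => v /(allP ss).
  rewrite interleavings_cons interleavings0l /= perm_cons.
  by rewrite (perm_trans (perm_map _ ps)) // map_cat map_nseq.
exists [seq false :: v | v <- interleavings [:: true] w].
  by rewrite all_map; apply/allP.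
by rewrite interleavings_cons interleavings0l.
Qed.

Lemma shuffle_triangular : leading_ones_triangular shuffle.
Proof.
move=> k ik; have [s ss ps] := interleavings_triangular (word_of_index k).
have lead : leading_ones k = leading_true (word_of_index k).
  by rewrite -leading_ones_index_of_word ?word_of_indexK ?last_word_of_index.
exists [seq index_of_word w | w <- s].
  rewrite all_map; apply/allP => w ws /=; rewrite is_index_index_of_word /=.
  rewrite lead leading_ones_index_of_word ?(allP ss) //.
  have := @last_interleavings [:: true] _ isT (last_word_of_index k).
  by rewrite (perm_all _ ps) all_cat => /andP[_ /allP]; apply.
rewrite /shuffle (perm_trans (perm_map _ ps)) // map_cat map_nseq lead.
by rewrite -word_of_index1 word_of_indexK.
Qed.

(** Induction on the number of leading ones. An index without any is admissible; otherwise the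
    product rule for [1] and k expresses a positive multiple of the value at 1 :: k through indices
    with fewer leading ones. *)
Lemma regularization_unique (R : realType) prod (f g : seq nat -> {poly R}) :
  leading_ones_triangular prod -> is_regularization prod f ->
  is_regularization prod g -> forall k, is_index k -> f k = g k.
Proof.
move=> tri [fa f1 fM] [ga g1 gM] k.
have [n] := ubnP (leading_ones k); elim: n k => [//|n IH] k lk ik.
have [ak|] := boolP (admissible k); first by rewrite fa // ga.
case: k lk ik => [//|a k] lk /= /andP[a0 ik]; rewrite -leqNgt => a1.
have {a0 a1}a1 : a = 1%N by lia.
rewrite {a}a1 in lk *.
have {}lk : (leading_ones k < n)%N by move: lk; rewrite /leading_ones /=; lia.
have [s ss ps] := tri k ik.
have fk : f k = g k by apply: IH => //; exact: leq_trans lk _.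
have := fM [:: 1%N] k isT ik; rewrite f1 fk -{1}g1 gM // => E.
move: E; rewrite !(perm_big _ ps) !big_cat !big_nseq !iter_addr_0.
have -> : \sum_(m <- s) f m = \sum_(m <- s) g m.
  apply: eq_big_seq => m /(allP ss) /andP[im lm].
  by apply: IH => //; apply: leq_ltn_trans lk.
move/addIr => E; apply/polyP => i; have /(congr1 (fun p : {poly R} => p`_i)) := E.
by rewrite !coefMn => /(pmulrnI (ltn0Sn _)) ->.
Qed.

End Products.

(** * Truncated sums and coefficients of polylogarithms *)

Section TruncatedSums.
Variable R : realType.
Implicit Types (k l : seq nat) (w : seq bool).

(* zN k M is the sum of m_1^-k_1 ... m_r^-k_r over M >= m_1 > ... > m_r >= 1. *)
Fixpoint zN k (M : nat) : R :=
  if k is a :: k' then \sum_(i < M) zN k' i / i.+1%:R ^+ a else 1.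

Lemma zN_cons a k M : zN (a :: k) M = \sum_(i < M) zN k i / i.+1%:R ^+ a.
Proof. by []. Qed.

Lemma zN_cons0 a k : zN (a :: k) 0 = 0.
Proof. by rewrite /= big_ord0. Qed.

Lemma zN_consS a k M :
  zN (a :: k) M.+1 = zN (a :: k) M + zN k M / M.+1%:R ^+ a.
Proof. by rewrite /= big_ord_recr. Qed.

Arguments zN : simpl never.

Lemma zN_ge0 k M : 0 <= zN k M.
Proof.
case: k => [//|a k]; elim: k a M => [|b k IH] a M; apply: sumr_ge0 => i _.
  by rewrite divr_ge0 // exprn_ge0.
by rewrite divr_ge0 ?IH // exprn_ge0.
Qed.

(** Going from M to M.+1 adds the terms whose largest variable is M.+1 in k only, in l only, or in
    both: these are the three parts of [stuffle_cons]. *)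
Lemma stuffle_zN k l M : zN k M * zN l M = \sum_(m <- stuffle k l) zN m M.
Proof.
elim: k l M => [|a k IHk] l M; first by rewrite stuffle0l big_seq1 mul1r.
elim: l M => [|b l IHl] M; first by rewrite stuffle0r big_seq1 mulr1.
rewrite stuffle_cons !big_cat !big_map.
elim: M => [|M IHM].
  rewrite zN_cons0 mul0r !big1 ?addr0 /= ?addr0 // => m _; exact: zN_cons0.
have S c s : \sum_(m <- s) zN (c :: m) M.+1 =
    \sum_(m <- s) zN (c :: m) M + (\sum_(m <- s) zN m M) / M.+1%:R ^+ c.
  by rewrite mulr_suml -big_split; apply: eq_bigr => m _; rewrite zN_consS.
move: IHM; rewrite /= !S -IHk -IHl -IHk exprD invfM !zN_consS => E.
rewrite !mulrDl !mulrDr E; ring.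
Qed.

(** The coefficient of z^n in the polylogarithm Li_k(z): the part of the truncated sum whose largest
    variable equals n. *)
Definition coefN k (n : nat) : R :=
  match k, n with
  | [::], _ => (n == 0%N)%:R
  | _, 0%N => 0
  | a :: k', i.+1 => zN k' i / i.+1%:R ^+ a
  end.

Lemma coefN_ge0 k n : 0 <= coefN k n.
Proof.
case: k n => [|a k] [|n]; rewrite /= ?ler01 //.
by rewrite divr_ge0 ?zN_ge0 // exprn_ge0.
Qed.

Lemma sum_coefN k M : \sum_(n < M.+1) coefN k n = zN k M.
Proof.
case: k => [|a k].
  by rewrite big_ord_recl /= big1 ?addr0.
by rewrite big_ord_recl /= add0r; apply: eq_bigr.
Qed.

(** Multiplication by z / (1 - z). *)
Definition fps_strict_sums (a : nat -> R) : nat -> R :=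
  fps_mul (fun n => (0 < n)%N%:R) a.

Lemma fps_strict_sumsE a n : fps_strict_sums a n = \sum_(i < n) a i.
Proof.
rewrite /fps_strict_sums fps_mulC /fps_mul big_ord_recr /= subnn mulr0 addr0.
by apply: eq_bigr => i _; rewrite subn_gt0 ltn_ord mulr1.
Qed.

Lemma fps_theta_inj (a b : nat -> R) :
  a 0%N = b 0%N -> fps_theta a = fps_theta b -> a = b.
Proof.
move=> ab0 E; apply/funext => -[//|n].
by have /(congr1 (fun f => f n.+1)) := E; exact: (pmulrnI (ltn0Sn n)).
Qed.

(* The coefficients of the polylogarithm of w: the letter 1 is integration of
   dz / (1 - z), the letter 0 of dz / z; the division by n = 0 gives 0, which
   is the right constant term. *)
Fixpoint coefW w : nat -> R :=
  match w with
  | [::] => fps_one R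
  | true :: w' => fun n => fps_strict_sums (coefW w') n / n%:R
  | false :: w' => fun n => coefW w' n / n%:R
  end.

Lemma coefW0 b w : coefW (b :: w) 0 = 0.
Proof. by case: b; rewrite /= invr0 mulr0. Qed.

Lemma fps_theta_div (a : nat -> R) : a 0%N = 0 ->
  fps_theta (fun n => a n / n%:R) = a.
Proof.
move=> a0; apply/funext => -[|n]; first by rewrite /fps_theta mulr0n a0.
by rewrite /fps_theta -[LHS]mulr_natr divfK ?pnatr_eq0.
Qed.

Lemma theta_coefW_true w :
  fps_theta (coefW (true :: w)) = fps_strict_sums (coefW w).
Proof. by rewrite fps_theta_div // fps_strict_sumsE big_ord0. Qed.

Lemma theta_coefW_false b w :
  fps_theta (coefW (false :: b :: w)) = coefW (b :: w).
Proof. exact: (@fps_theta_div (coefW (b :: w)) (coefW0 b w)). Qed.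

Lemma last_true_false w : last true (false :: w) ->
  exists b v, w = b :: v.
Proof. by case: w => // b v; exists b, v. Qed.

Lemma last_true_behead b w : last true (b :: w) -> last true w.
Proof. by case: w. Qed.

(** Relative to z d/dz, the forms dz / (1 - z) and dz / z become multiplication by z / (1 - z) and
    by 1; both commute with multiplication by a series. *)
Definition theta_letter b (a : nat -> R) := if b then fps_strict_sums a else a.

Lemma theta_coefW b w : last true (b :: w) ->
  fps_theta (coefW (b :: w)) = theta_letter b (coefW w).
Proof.
(* A leading 0 is followed by another letter, so the series integrated against dz / z has zero
   constant term. *)
case: b => [|/last_true_false[c [v ->]]]; first by rewrite theta_coefW_true.
exact: theta_coefW_false.
Qed.

Lemma theta_letter_mull b a c :
  fps_mul (theta_letter b a) c = theta_letter b (fps_mul a c).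
Proof. by case: b => //=; rewrite /fps_strict_sums fps_mulA. Qed.

Lemma fps_mul_sum I (s : seq I) (F : I -> nat -> R) a :
  fps_mul a (fun n => \sum_(i <- s) F i n) =
    fun n => \sum_(i <- s) fps_mul a (F i) n.
Proof.
apply/funext => n; rewrite /fps_mul exchange_big /=; apply: eq_bigr => j _.
by rewrite mulr_sumr.
Qed.

Lemma theta_letter_sum I (s : seq I) (F : I -> nat -> R) b :
  theta_letter b (fun n => \sum_(i <- s) F i n) =
    fun n => \sum_(i <- s) theta_letter b (F i) n.
Proof. by case: b => //=; apply: fps_mul_sum. Qed.

(** The product rule for [fps_theta] removes the first letter of u or of v, exactly as the recursion
    of interleavings does, and for nonempty words both constant terms vanish. *)
Lemma coefW_interleavings u v : last true u -> last true v ->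
  fps_mul (coefW u) (coefW v) =
    fun n => \sum_(w <- interleavings u v) coefW w n.
Proof.
elim: u v => [|a u IHu] v.
  move=> _ _; rewrite interleavings0l /= fps_mul1.
  by under eq_fun do rewrite big_seq1.
elim: v => [|b v IHv] lu lv.
  rewrite interleavings0r fps_mulC /= fps_mul1.
  by under [RHS]eq_fun do rewrite big_seq1.
have lu' := last_true_behead lu; have lv' := last_true_behead lv.
apply: fps_theta_inj.
  rewrite /fps_mul big_ord1 coefW0 mul0r interleavings_cons big_cat !big_map.
  by rewrite !big1 => [|w _|w _]; rewrite ?coefW0 //= addr0.
rewrite fps_theta_mul theta_coefW // theta_letter_mull IHu //.
rewrite theta_coefW // [fps_mul _ (theta_letter _ _)]fps_mulC theta_letter_mull.
rewrite [fps_mul (coefW v) _]fps_mulC IHv // !theta_letter_sum.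
apply/funext => n; rewrite /fps_theta -sumrMnl interleavings_cons.
have lI := last_interleavings lu lv.
rewrite [RHS]big_cat !big_map.
move: lI; rewrite interleavings_cons all_cat !all_map => /andP[/allP l1 /allP l2].
congr (_ + _); apply: eq_big_seq => w wi.
  by rewrite -theta_coefW //; exact: l1.
by rewrite -theta_coefW //; exact: l2.
Qed.

Lemma coefW_word_of_index k : is_index k -> coefW (word_of_index k) = coefN k.
Proof.
elim: k => [//|a k IH] /= /andP[a0 ik].
have H n : coefW (nseq a.-1 false ++ true :: word_of_index k) n = 
    coefN (a :: k) n.
  case: n => [|n]; first by case: (a.-1) => *; rewrite coefW0.
  case: a a0 => [//|a] _ /=; elim: a => [|a IHa] /=.
    by rewrite fps_strict_sumsE IH // sum_coefN expr1.
  by rewrite IHa -mulrA -invfM -exprSr.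
apply/funext => n; rewrite -H; congr (coefW _ n).
by rewrite /word_of_index /= cat_rcons.
Qed.

Lemma coefN_index_of_word w : last true w ->
  coefN (index_of_word w) = coefW w.
Proof.
move=> lw; rewrite -coefW_word_of_index ?is_index_index_of_word //.
congr coefW; rewrite /word_of_index /index_of_word.
(* Generalized to the state in which n zeros have been read since the last 1. *)
have H n v : last true (nseq n false ++ v) ->
    flatten [seq rcons (nseq i.-1 false) true | i <- index_of_word_rec n v] =
    nseq n false ++ v.
  elim: v n => [|[] v IH] n /=.
  - rewrite cats0; case: n => [//|n] /=.
    by have -> : last false (nseq n false) = false by elim: n.
  - rewrite last_cat /= => lv; rewrite (IH 0%N) //=; first by rewrite cat_rcons.
  - have -> : nseq n false ++ false :: v = nseq n.+1 false ++ v.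
      by elim: n => [//|n /= ->].
    exact: IH.
exact: (H 0%N).
Qed.

Lemma coefN_shuffle k l : is_index k -> is_index l ->
  fps_mul (coefN k) (coefN l) = fun n => \sum_(m <- shuffle k l) coefN m n.
Proof.
move=> ik il; rewrite -!coefW_word_of_index // coefW_interleavings;
  try exact: last_word_of_index.
apply/funext => n; rewrite big_map; apply: eq_big_seq => w wi.
rewrite coefN_index_of_word //; apply: (allP _ w wi).
by apply: last_interleavings; apply: last_word_of_index.
Qed.

End TruncatedSums.

Arguments zN R k M : simpl never.

(** * Asymptotic expansions of truncated sums *)

Section Asymptotics.
Variable R : realType.
Local Notation zN := (@zN R).

(* The j-th elementary symmetric function of 1, 1/2, ..., 1/m. *)
Definition esymN j m : R := zN (nseq j 1%N) m.
Local Notation e := esymN.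
Local Notation H := (esymN 1).

Lemma esymN0 m : e 0 m = 1. Proof. by []. Qed.

Lemma esymN_0 j : e j 0 = (j == 0%N)%:R.
Proof. by case: j => [//|j]; exact: zN_cons0. Qed.

Lemma esymNS j m : e j.+1 m.+1 = e j.+1 m + e j m / m.+1%:R.
Proof. by rewrite [LHS]zN_consS expr1. Qed.

Lemma esymN_sum j m : e j.+1 m = \sum_(i < m) e j i / i.+1%:R.
Proof. by apply: eq_bigr => i _; rewrite expr1. Qed.

Lemma esymN_ge0 j m : 0 <= e j m. Proof. exact: zN_ge0. Qed.

Lemma le_esymN_mono j m n : (m <= n)%N -> e j m <= e j n.
Proof.
elim: n => [|n IH]; first by rewrite leqn0 => /eqP->.
rewrite leq_eqVlt ltnS => /orP[/eqP->//|/IH le]; apply: (le_trans le).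
case: j {IH le} => [|j]; first by rewrite !esymN0.
by rewrite esymNS lerDl divr_ge0 ?esymN_ge0.
Qed.

(** A factor 1/i of H is either new, and each product in e_(j+1) arises j + 1 times in this way, or
    repeats one of the j factors present, which does not increase the product. *)
Lemma harmonic_mul_esymN j m :
  H m * e j m <= j.+1%:R * e j.+1 m + j%:R * e j m.
Proof.
elim: m j => [|m IH] j.
  by rewrite !esymN_0 mul0r addr_ge0 // mulr_ge0.
case: j => [|j]; first by rewrite esymN0 mulr1 mul1r mul0r addr0.
rewrite !esymNS esymN0 mul1r; set x := m.+1%:R^-1.
have x0 : 0 <= x by rewrite invr_ge0.
have x1 : x <= 1 by rewrite invf_le1 ?ler1n ?ltr0n.
have := IH j.+1; have := ler_wpM2l x0 (IH j); have := esymN_ge0 j m.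
move: (e j m) (e j.+1 m) (e j.+2 m) (H m) => e0 e1 e2 h e0_ge0.
rewrite -!natr1; move: (j%:R) (ler0n R j) => J J0 H1 H2.
have H3 : 0 <= J * e0 * x by rewrite !mulr_ge0.
have H4 : 0 <= x * (1 - x) * e0 by rewrite !mulr_ge0 // subr_ge0.
lra.
Qed.

(** A substitute for powers of log m, chosen because its quotient by m + 1 telescopes exactly. *)
Definition esymN_sums J m : R := \sum_(j < J) e j m.
Local Notation W := esymN_sums.

Lemma esymN_sums_ge0 J m : 0 <= W J m.
Proof. by apply: sumr_ge0 => j _; apply: esymN_ge0. Qed.

Lemma le_esymN_sums J K m : (J <= K)%N -> W J m <= W K m.
Proof.
elim: K => [|K IH]; first by rewrite leqn0 => /eqP->.
rewrite leq_eqVlt ltnS => /orP[/eqP->//|/IH le]; apply: (le_trans le).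
by rewrite /W big_ord_recr /= lerDl esymN_ge0.
Qed.

Lemma esymN_le_sums j J m : (j < J)%N -> e j m <= W J m.
Proof.
move/(le_esymN_sums m); apply: le_trans; rewrite /W big_ord_recr /= lerDr.
exact: esymN_sums_ge0.
Qed.

(** Discrete counterpart of the antiderivative of (log m)^J / m^2; it gives both monotonicity and
    tail estimates. *)
Lemma esymN_sums_telescope J m :
  W J.+1 m / m.+1%:R - W J.+1 m.+1 / m.+2%:R =
  e J m / (m.+1%:R * m.+2%:R).
Proof.
have m1 : 1 + m%:R != 0 :> R by rewrite nat1r pnatr_eq0.
have m2 : 1 + (1 + m%:R) != 0 :> R by rewrite !nat1r pnatr_eq0.
elim: J => [|J IH].
  rewrite /W !big_ord1 !esymN0 -!nat1r; field; apply/andP; split=> //.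
rewrite /W big_ord_recr -/(W J.+1 m) [X in _ - X / _]big_ord_recr.
rewrite -/(W J.+1 m.+1) /= esymNS.
have -> : e J.+1 m / (m.+1%:R * m.+2%:R) =
  e J m / (m.+1%:R * m.+2%:R) +
  (e J.+1 m / m.+1%:R - (e J.+1 m + e J m / m.+1%:R) / m.+2%:R).
  rewrite -!nat1r; field; apply/andP; split=> //.
by rewrite -IH; ring.
Qed.

(** For positive J the quotient equals 1 at m = 0, and it decreases by the telescoping identity. *)
Lemma esymN_sums_div_le1 J m : W J m / m.+1%:R <= 1.
Proof.
case: J => [|J]; first by rewrite /W big_ord0 mul0r.
elim: m => [|m IH].
  rewrite /W big_ord_recl big1 ?addr0 ?divr1 // => j _.
  by rewrite esymN_0.
apply: le_trans IH; rewrite -subr_ge0 esymN_sums_telescope.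
by rewrite divr_ge0 ?esymN_ge0 // mulr_ge0.
Qed.

(* Up to powers of log m, this is O(1/m); unlike O(m^-s) for a fixed exponent
   s, it is stable under multiplication by H. *)
Definition small (u : nat -> R) := exists (C : R) (J : nat),
  0 <= C /\ forall m, `|u m| <= C * (W J m / m.+1%:R).

Lemma small_le (u v : nat -> R) K :
  small u -> (forall m, `|v m| <= K * `|u m|) -> small v.
Proof.
move=> [C [J [C0 uC]]] vu; exists (`|K| * C), J; split; first exact: mulr_ge0.
move=> m; apply: (le_trans (vu m)); apply: (@le_trans _ _ (`|K| * `|u m|)).
  by rewrite ler_wpM2r ?ler_norm.
by rewrite -mulrA ler_wpM2l.
Qed.

Lemma smallD u v : small u -> small v -> small (fun m => u m + v m).
Proof.
move=> [C [J [C0 uC]]] [D [K [D0 vD]]].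
exists (C + D), (maxn J K); split; first exact: addr_ge0.
move=> m; apply: (le_trans (ler_normD _ _)); rewrite mulrDl.
have le J' : (J' <= maxn J K)%N ->
    W J' m / m.+1%:R <= W (maxn J K) m / m.+1%:R.
  by move=> JK; rewrite ler_wpM2r ?invr_ge0 // le_esymN_sums.
by apply: lerD; [apply: (le_trans (uC m))|apply: (le_trans (vD m))];
  rewrite ler_wpM2l // le // ?leq_maxl ?leq_maxr.
Qed.

Lemma small0 : small (fun=> 0).
Proof.
by exists 0, 0%N; split=> // m; rewrite normr0 mul0r.
Qed.

Lemma smallZ c u : small u -> small (fun m => c * u m).
Proof. by move/small_le; apply=> m; rewrite normrM. Qed.

Lemma smallN u : small u -> small (fun m => - u m).
Proof. by move/(@small_le _ _ 1); apply=> m; rewrite normrN mul1r. Qed.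

Lemma smallB u v : small u -> small v -> small (fun m => u m - v m).
Proof. by move=> su sv; apply: smallD => //; apply: smallN. Qed.

Lemma small_sum (I : eqType) (s : seq I) (F : I -> nat -> R) :
  (forall i, i \in s -> small (F i)) -> small (fun m => \sum_(i <- s) F i m).
Proof.
elim: s => [|i s IH] sF.
  by under eq_fun do rewrite big_nil; exact: small0.
under eq_fun do rewrite big_cons; apply: smallD; first by apply: sF; rewrite mem_head.
by apply: IH => j js; apply: sF; rewrite inE js orbT.
Qed.

Lemma harmonic_mul_sums J m : H m * W J m <= J%:R * 2 * W J.+1 m.
Proof.
rewrite mulr_sumr.
apply: (@le_trans _ _ (\sum_(j < J) (J%:R * (e j.+1 m + e j m)))).
  apply: ler_sum => j _; apply: (le_trans (harmonic_mul_esymN j m)).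
  by rewrite mulrDr lerD // ler_wpM2r ?esymN_ge0 // ler_nat // ltnW.
rewrite -mulr_sumr -mulrA ler_wpM2l // big_split mulr_natl mulr2n lerD //.
  by rewrite /W big_ord_recl lerDr esymN_ge0.
exact: le_esymN_sums.
Qed.

Lemma zN_le_esymN k m : is_index k -> zN k m <= e (size k) m.
Proof.
elim: k m => [|a k IH] m; first by rewrite esymN0.
move=> /= /andP[a0 ik]; rewrite esymN_sum; apply: ler_sum => i _.
rewrite ler_pM ?zN_ge0 ?invr_ge0 ?exprn_ge0 ?IH //.
by rewrite lef_pV2 ?qualifE/= ?exprn_gt0 ?ltr0n // ler_eXnr ?ler1n.
Qed.

Lemma small_mul_harmonic u : small u -> small (fun m => H m * u m).
Proof.
move=> [C [J [C0 uC]]]; exists (C * (J%:R * 2)), J.+1.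
split; first by rewrite !mulr_ge0.
move=> m; rewrite normrM ger0_norm ?esymN_ge0 //.
apply: (le_trans (ler_wpM2l (esymN_ge0 1 m) (uC m))).
rewrite mulrCA -[leRHS]mulrA ler_wpM2l // !mulrA ler_wpM2r ?invr_ge0 //.
exact: harmonic_mul_sums.
Qed.

Lemma esymN_le_harmonic j m : e j m <= (1 + H m) ^+ j.
Proof.
elim: j m => [|j IH] m; first by rewrite esymN0 expr0.
rewrite esymN_sum exprS.
apply: (@le_trans _ _ (H m * (1 + H m) ^+ j)); last first.
  by rewrite ler_wpM2r ?exprn_ge0 ?addr_ge0 ?esymN_ge0 // lerDr.
rewrite {1}esymN_sum mulr_suml; apply: ler_sum => i _.
rewrite esymN0 mul1r mulrC ler_wpM2l ?invr_ge0 //.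
apply: (le_trans (IH i)).
have H0 n : 1 + H n \is Num.nneg.
  by rewrite nnegrE addr_ge0 ?ler01 ?esymN_ge0.
by apply: lerXn2r => //; rewrite lerD2l le_esymN_mono // ltnW.
Qed.

Lemma small_mul u v K r : small u ->
  (forall m, `|v m| <= K * (1 + H m) ^+ r) -> small (fun m => v m * u m).
Proof.
move=> su vK; have : small (fun m => (1 + H m) ^+ r * u m).
  elim: r {vK} => [|r IH]; first by under eq_fun do rewrite expr0 mul1r.
  under eq_fun do rewrite exprS -mulrA mulrDl mul1r.
  by apply: smallD => //; apply: small_mul_harmonic.
move/(@small_le _ _ K); apply=> m; rewrite !normrM mulrA ler_wpM2r //.
by rewrite [`|_ ^+ _|]ger0_norm // exprn_ge0 // addr_ge0 // esymN_ge0.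
Qed.

Lemma small_mul_zN u k : is_index k -> small u -> small (fun m => zN k m * u m).
Proof.
move=> ik su; apply: (small_mul (K := 1) (r := size k)) su _ => m.
rewrite ger0_norm ?zN_ge0 // mul1r; apply: le_trans (esymN_le_harmonic _ _).
exact: zN_le_esymN.
Qed.

Lemma small_mul_poly u (p : {poly R}) :
  small u -> small (fun m => p.[H m] * u m).
Proof.
elim/poly_ind: p => [|p c IH] su.
  by under eq_fun do rewrite horner0 mul0r; exact: small0.
under eq_fun do rewrite !hornerE mulrDl mulrAC mulrC.
by apply: smallD; [apply/small_mul_harmonic/IH|apply: smallZ].
Qed.

Lemma small_harmonic_bounded u : small u -> exists C, forall m, `|u m| * H m <= C.
Proof.
move=> /small_mul_harmonic[C [J [C0 uC]]]; exists C => m.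
rewrite -[H m]ger0_norm ?esymN_ge0 // -normrM mulrC.
by apply: (le_trans (uC m)); rewrite ler_piMr // esymN_sums_div_le1.
Qed.

Lemma harmonic_unbounded (B : R) : exists N, forall m, (N <= m)%N -> B <= H m.
Proof.
have [[N BN]|noN] := pselect (exists N, B <= H N).
  by exists N => m Nm; apply: (le_trans BN); apply: le_esymN_mono.
exfalso; apply: (@dvg_harmonic R); apply: nondecreasing_is_cvgn.
  apply/nondecreasing_seqP => n; rewrite /series /= big_nat_recr //= lerDl.
  by rewrite invr_ge0.
exists B => _ [n _ <-].
have -> : series harmonic n = H n.
  rewrite esymN_sum /series /= big_mkord; apply: eq_bigr => i _.
  by rewrite esymN0 mul1r.
by rewrite leNgt; apply/negP => /ltW BH; apply: noN; exists n.
Qed.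

(** The product of H and u is still small, hence bounded, while H tends to infinity. *)
Lemma small_cvg0 u : small u -> (u @ \oo --> (0 : R))%classic.
Proof.
move=> /small_harmonic_bounded[C uC]; apply/cvgr0Pnorm_lt => eps eps0.
(* The extra 1 makes eps times this threshold equal to C + eps, which exceeds the bound C. *)
have [N HN] := harmonic_unbounded (C / eps + 1).
exists N => // m /= Nm; have := HN m Nm; have := uC m.
move: (H m) (`|u m|) (esymN_ge0 1 m) => h x h0 xh hb.
rewrite ltNge; apply/negP => ex.
have : eps * (C / eps + 1) <= C.
  apply: le_trans xh; apply: (@le_trans _ _ (eps * h)).
    by rewrite ler_wpM2l // ltW.
  by rewrite ler_wpM2r.
by rewrite mulrDr mulrCA divff ?gt_eqF // !mulr1 gerDl leNgt eps0.
Qed.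

(** A polynomial with positive leading coefficient eventually stays above that coefficient, and H is
    unbounded. This turns asymptotic relations into identities of polynomials. *)
Lemma small_poly_eq0 (p : {poly R}) : small (fun m => p.[H m]) -> p = 0.
Proof.
wlog lp : p / 0 <= lead_coef p => [hw|] sp.
  have [/hw->//|/ltW lp] := leP 0 (lead_coef p).
  apply/oppr_inj; rewrite oppr0; apply: hw; first by rewrite lead_coefN oppr_ge0.
  by under eq_fun do rewrite hornerN; apply: smallN.
apply/eqP; move: lp; rewrite le_eqVlt eq_sym lead_coef_eq0 => /orP[//|lp].
have [x px] := poly_pinfty_gt_lc lp; have [N HN] := harmonic_unbounded x.
have /cvgr0Pnorm_lt /(_ _ lp) [M _ pM] := small_cvg0 sp.
have := pM (maxn N M) (leq_maxr _ _).
rewrite ltNge (le_trans (px _ (HN _ (leq_maxl N M)))) //.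
exact: ler_norm.
Qed.

(** The sequences t + g and t - g are monotone in opposite directions and enclose the common
    limit. *)
Lemma telescoping_cvgn (t g : nat -> R) :
    (forall m, `|t m.+1 - t m| <= g m - g m.+1) -> (g @ \oo --> (0 : R))%classic ->
  cvgn t /\ forall m, `|t m - limn t| <= g m.
Proof.
move=> tg g0.
have gi : nonincreasing_seq g.
  apply/nonincreasing_seqP => n; rewrite -subr_ge0.
  exact: le_trans (normr_ge0 _) (tg n).
have gpos m : 0 <= g m.
  rewrite -(cvg_lim (@Rhausdorff R) g0); apply: nonincreasing_cvgn_ge => //.
  by apply/cvg_ex; exists 0.
pose up m := t m + g m; pose lo m := t m - g m.
have upi : nonincreasing_seq up.
  apply/nonincreasing_seqP => n; have := tg n; rewrite ler_norml /up.
  by move=> /andP[_]; lra.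
have loi : nondecreasing_seq lo.
  apply/nondecreasing_seqP => n; have := tg n; rewrite ler_norml /lo.
  by move=> /andP[]; lra.
have cup : cvgn up.
  apply: nonincreasing_is_cvgn => //; exists (lo 0%N) => _ [n _ <-].
  apply: (le_trans (loi _ _ (leq0n n))); rewrite /lo /up.
  by have := gpos n; lra.
have clo : cvgn lo.
  apply: nondecreasing_is_cvgn => //; exists (up 0%N) => _ [n _ <-].
  apply: le_trans (upi _ _ (leq0n n)); rewrite /lo /up.
  by have := gpos n; lra.
have tE : (t @ \oo --> limn up)%classic.
  have -> : t = up \- g by apply/funext => n /=; rewrite /up addrK.
  by rewrite -[limn up]subr0; apply: cvgB.
have ct : cvgn t by apply/cvg_ex; exists (limn up).
have limt : limn t = limn up by apply: cvg_lim tE.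
have limt' : limn t = limn lo.
  apply/esym/cvg_lim => //.
  have -> : lo = t \- g by [].
  by rewrite -[limn t]subr0; apply: cvgB.
split=> // m; rewrite ler_norml.
have := nonincreasing_cvgn_ge upi cup m; rewrite -limt.
have := nondecreasing_cvgn_le loi clo m; rewrite -limt'.
by rewrite /up /lo => h1 h2; apply/andP; split; lra.
Qed.

Lemma small_series (u : nat -> R) (t := fun m => \sum_(i < m) u i / i.+1%:R) :
  small u -> cvgn t /\ small (fun m => t m - limn t).
Proof.
move=> [C [J [C0 uC]]].
(* The antiderivative from [esymN_sums_telescope]; the factor 2 pays for replacing (m + 1)^2 by (m +
   1)(m + 2). *)
pose g m := 2 * C * \sum_(j < J) W j.+1 m / m.+1%:R.
have gW m : g m <= 2 * C * J%:R * (W J m / m.+1%:R).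
  rewrite /g -[leRHS]mulrA ler_wpM2l ?mulr_ge0 //.
  apply: (@le_trans _ _ (\sum_(j < J) W J m / m.+1%:R)).
    apply: ler_sum => j _; rewrite ler_wpM2r ?invr_ge0 //.
    exact: le_esymN_sums.
  by rewrite big_const_ord iter_addr_0 mulr_natl.
have g_ge0 m : 0 <= g m.
  rewrite mulr_ge0 ?mulr_ge0 // sumr_ge0 // => j _.
  by rewrite divr_ge0 ?esymN_sums_ge0.
have sg : small g.
  exists (2 * C * J%:R), J; split; first by rewrite !mulr_ge0.
  by move=> m; rewrite ger0_norm.
have tg m : `|t m.+1 - t m| <= g m - g m.+1.
  have -> : t m.+1 - t m = u m / m.+1%:R.
    by rewrite /t big_ord_recr /= addrAC subrr add0r.
  rewrite normrM -mulrBr -sumrB.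
  under eq_bigr do rewrite esymN_sums_telescope.
  rewrite -mulr_suml -/(W J m) [`|_^-1|]ger0_norm ?invr_ge0 //.
  apply: (@le_trans _ _ (C * (W J m / m.+1%:R) / m.+1%:R)).
    by rewrite ler_wpM2r ?invr_ge0.
  have -> : C * (W J m / m.+1%:R) / m.+1%:R =
    C * W J m * (m.+1%:R^-1 * m.+1%:R^-1) by ring.
  have -> : 2 * C * (W J m / (m.+1%:R * m.+2%:R)) =
    C * W J m * (2 / (m.+1%:R * m.+2%:R)) by ring.
  rewrite ler_wpM2l ?mulr_ge0 ?esymN_sums_ge0 // invfM mulrCA.
  rewrite ler_wpM2l ?invr_ge0 // ler_pdivlMr ?ltr0n // mulrC.
  by rewrite ler_pdivrMr ?ltr0n // -natrM ler_nat; lia.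
have [ct lt] := telescoping_cvgn tg (small_cvg0 sg).
split=> //; apply: (small_le (K := 1) sg) => m.
by rewrite mul1r [`|g m|]ger0_norm.
Qed.

(** As a is at least 2, a factor 1 / i.+1 remains after one is set aside for [small_series]. *)
Lemma zN_series_small a k : (1 < a)%N -> is_index k ->
  small (fun i => zN k i / i.+1%:R ^+ a.-1).
Proof.
move=> a1 ik; exists 1, (size k).+1; split=> // m.
rewrite mul1r ger0_norm ?divr_ge0 ?zN_ge0 ?exprn_ge0 //.
rewrite ler_pM ?zN_ge0 ?invr_ge0 ?exprn_ge0 //.
- by apply: (le_trans (zN_le_esymN _ ik)); apply: esymN_le_sums.
- rewrite lef_pV2 ?qualifE/= ?exprn_gt0 ?ltr0n // ler_eXnr ?ler1n //; lia.
Qed.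

Lemma admissible_zN k : is_index k -> admissible k ->
  cvgn (zN k) /\ small (fun m => zN k m - limn (zN k)).
Proof.
case: k => [|a k] /=.
  move=> _ _; split; first exact: is_cvg_cst.
  have -> : limn (zN [::]) = 1 by apply: lim_cst.
  by under eq_fun do rewrite subrr; exact: small0.
move=> /andP[a0 ik] a1.
pose T m := \sum_(i < m) zN k i / i.+1%:R ^+ a.-1 / i.+1%:R.
have <- : T = zN (a :: k).
  apply/funext => m; apply: eq_bigr => i _.
  by rewrite -mulrA -invfM -exprSr prednK.
exact: small_series (zN_series_small a1 ik).
Qed.

(** The coefficients d_j(k) of the expansion in the e_j(m). A leading 1 shifts them by one place,
    since summing e_j(i) / (i + 1) gives e_(j+1); the new head is the limit of what the shifted
    terms leave over. *)
Fixpoint zeta_coefs k : seq R :=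
  match k with
  | [::] => [:: 1]
  | a :: k' =>
      let t := if a == 1%N then zeta_coefs k' else [::] in
      limn (fun m => zN k m - \sum_(j < size t) t`_j * e j.+1 m) :: t
  end.

Lemma zeta_coefs_small k : is_index k -> small (fun m =>
  zN k m - \sum_(j < size (zeta_coefs k)) (zeta_coefs k)`_j * e j m).
Proof.
elim: k => [_|a k IH].
  under eq_fun do rewrite big_ord1 mul1r esymN0 subrr; exact: small0.
move=> /andP[a0 ik] /=; set t := if _ then _ else _; set L := limn _.
have E m : zN (a :: k) m - \sum_(j < (size t).+1) (L :: t)`_j * e j m =
    zN (a :: k) m - \sum_(j < size t) t`_j * e j.+1 m - L.
  by rewrite big_ord_recl esymN0 mulr1 opprD addrA addrAC.
under eq_fun do rewrite E.
rewrite /L {E L} /t; have [a1|a1] := eqVneq a 1%N; last first.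
  under [X in limn X]eq_fun do rewrite big_ord0 subr0.
  under eq_fun do rewrite big_ord0 subr0.
  by apply: (admissible_zN (k := a :: k) _ _).2; rewrite /= ?a0 //; lia.
rewrite {}a1 {a0}; set t := zeta_coefs k.
(* Summing the remainder for k against 1 / i.+1 gives the very sequence whose limit is the head of
   the new list. *)
pose T m := \sum_(i < m) (zN k i - \sum_(j < size t) t`_j * e j i) / i.+1%:R.
have [_] : cvgn T /\ small (fun m => T m - limn T) := small_series (IH ik).
have -> : T = fun m => zN (1%N :: k) m - \sum_(j < size t) t`_j * e j.+1 m.
  apply/funext => m; rewrite /T.
  under eq_bigr do rewrite mulrBl; rewrite sumrB; congr (_ - _).
  under eq_bigr do rewrite mulr_suml; rewrite exchange_big /=.
  apply: eq_bigr => j _; rewrite esymN_sum mulr_sumr; apply: eq_bigr => i _.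
  by rewrite mulrA.
by [].
Qed.

End Asymptotics.

(** * Multiple zeta values as limits *)

Section ConvergentValues.
Variable R : realType.
Local Notation zN := (@zN R).

(** Enumerates the tuples of [mzv_domain r] with entries at most M, to compare truncated sums with
    the unordered sum in [mzv]. *)
Fixpoint decreasing_seqs (r M : nat) : seq (seq nat) :=
  if r is r'.+1 then
    [seq i.+1 :: s | i <- iota 0 M, s <- decreasing_seqs r' i]
  else [:: [::]].

Lemma mem_decreasing_seqs r M s : (s \in decreasing_seqs r M) =
  [&& size s == r, sorted gtn s, all (fun n => 0 < n)%N s
    & all (fun n => n <= M)%N s].
Proof.
elim: r M s => [|r IH] M s; first by case: s.
have gtn_trans : transitive gtn by move=> y x z /= yx zy; exact: ltn_trans yx.
apply/allpairsPdep/idP => [[i [t [iM]]]|].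
  rewrite IH mem_iota in iM * => /and4P[st so t0 ti] ->.
  rewrite /= eqSS st /= path_sortedE // so t0 andbT /=.
  apply/and3P; split; last 2 first.
  - by move: iM; rewrite /= add0n.
  - by apply: sub_all ti => n /= ni; move: iM; rewrite /= add0n; lia.
  by apply: sub_all ti => n; rewrite /= ltnS.
case: s => [|[|i] s] /=; rewrite ?andbF // eqSS path_sortedE //.
case/and4P => sr /andP[si so] s0 /andP[iM sM].
exists i, s; split=> //; first by rewrite mem_iota add0n.
by rewrite IH sr so s0 /=; apply: sub_all si => n; rewrite /= ltnS.
Qed.

Lemma uniq_decreasing_seqs r M : uniq (decreasing_seqs r M).
Proof.
elim: r M => [//|r IH] M.
apply: allpairs_uniq_dep; [exact: iota_uniq|by move=> i _; exact: IH|].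
by move=> [i s] [j t] _ _ /= [-> ->].
Qed.

Lemma sum_decreasing_seqs k M :
  \sum_(s <- decreasing_seqs (size k) M) mzv_term R k s = zN k M.
Proof.
elim: k M => [|a k IH] M; first by rewrite big_seq1 /mzv_term big_nil.
rewrite big_allpairs_dep zN_cons.
rewrite (_ : iota 0 M = index_iota 0 M); last by rewrite /index_iota subn0.
rewrite big_mkord; apply: eq_bigr => i _; rewrite -IH mulr_suml.
by apply: eq_bigr => s _; rewrite /mzv_term /= big_cons mulrC.
Qed.

Lemma mzv_term_ge0 k s : 0 <= mzv_term R k s.
Proof. by apply: prodr_ge0 => p _; rewrite invr_ge0 exprn_ge0. Qed.

Lemma zN_nondecreasing k : nondecreasing_seq (zN k).
Proof.
apply/nondecreasing_seqP => n; case: k => [//|a k].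
by rewrite zN_consS lerDl divr_ge0 ?zN_ge0 // exprn_ge0.
Qed.

Lemma mzvE k : is_index k -> admissible k -> mzv R k = limn (zN k).
Proof.
move=> ik ak; have [ck _] := admissible_zN R ik ak.
have fsumE M : (\sum_(s \in [set` decreasing_seqs (size k) M])
    (mzv_term R k s)%:E)%E = (zN k M)%:E.
  by rewrite -fsbig_seq ?uniq_decreasing_seqs // sumEFin sum_decreasing_seqs.
rewrite /mzv; set S := (\esum_(m in _) _)%E.
have ub : (S <= (limn (zN k))%:E)%E.
  apply: ge_ereal_sup => _ [A [finA AS] <-].
  (* M adds up all entries of the tuples listed in t, so it bounds every entry of every tuple of
     A. *)
  have /finite_seqP[t At] := finA; pose M := (\sum_(s <- t) sumn s)%N.
  apply: (@le_trans _ _ (zN k M)%:E); last first.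
    by rewrite lee_fin; apply: nondecreasing_cvgn_le => //; exact: zN_nondecreasing.
  rewrite -fsumE; apply: lee_fsum_nneg_subset => //; first exact: finite_seq.
    move=> s; rewrite inE => sA; rewrite inE /= mem_decreasing_seqs.
    have [-> /andP[-> ->]] := AS _ sA; rewrite eqxx /=.
    apply/allP => n ns; apply: (@leq_trans (sumn s)).
      by elim: s ns {sA} => [//|m s IHs]; rewrite inE => /orP[/eqP->|/IHs] /=; lia.
    by rewrite /M (big_rem s) /= ?leq_addr //; move: sA; rewrite At.
  by move=> s _; rewrite lee_fin mzv_term_ge0.
have lb M : ((zN k M)%:E <= S)%E.
  apply: esum_ge.
  exists [set` decreasing_seqs (size k) M]%classic; last by rewrite fsumE.
  split=> [|s /=]; first exact: finite_seq.
  rewrite mem_decreasing_seqs => /and4P[/eqP sk so s0 _].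
  by split=> //; rewrite so s0.
have : S \is a fin_num.
  rewrite fin_numE; apply/andP; split.
    by rewrite gt_eqF // (lt_le_trans _ (lb 0%N)) // ltNyr.
  by rewrite lt_eqF // (le_lt_trans ub) // ltry.
move=> /fineK SE; apply/eqP; rewrite eq_le -lee_fin SE ub /=.
apply: limr_le => //; apply: nearW => M.
by rewrite -lee_fin SE.
Qed.

End ConvergentValues.

(** * Elementary symmetric functions as polynomials in harmonic numbers *)

Section HarmonicExpansion.
Variable R : realType.
Local Notation zN := (@zN R).
Local Notation e := (@esymN R).
Local Notation H := (@esymN R 1).

Lemma fps_mul_map (A B : comNzRingType) (f : {rmorphism A -> B}) (a b : nat -> A) :
  fps_mul (fun n => f (a n)) (fun n => f (b n)) = fun n => f (fps_mul a b n).
Proof.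
apply/funext => n; rewrite /fps_mul rmorph_sum; apply: eq_bigr => i _.
by rewrite rmorphM.
Qed.

(** The coefficients of theta(log A(u)); with them [invA] satisfies the first-order equation
    [theta_invA]. *)
Definition zeta_signed (n : nat) : R :=
  if (n < 2)%N then 0 else (-1) ^+ n * mzv R [:: n].

(* The inverse of the series exp(\sum_(n >= 2) (-1)^n / n zeta(n) u^n). *)
Definition invA : nat -> R := fps_exp (fun n => - zeta_signed n / n%:R).

Lemma natr_neq0 n : (0 < n)%N -> n%:R != 0 :> R.
Proof. by rewrite pnatr_eq0 -lt0n. Qed.

Lemma invA0 : invA 0 = 1. Proof. exact: fps_exp0. Qed.

Lemma theta_invA :
  fps_theta invA = fps_mul (fun n => - zeta_signed n) invA.
Proof.
rewrite /invA fps_theta_exp; last by rewrite invr0 mulr0.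
  congr fps_mul; apply: fps_theta_div; by rewrite /zeta_signed oppr0.
exact: natr_neq0.
Qed.

Definition expT (F : fieldType) (n : nat) : {poly F} := (n`!%:R)^-1 *: 'X^n.

Lemma theta_expT :
  fps_theta (expT R) = fps_mul (fun n => 'X *+ (n == 1%N)) (expT R).
Proof.
apply/funext => -[|n]; rewrite /fps_theta /fps_mul.
  by rewrite mulr0n big_ord1 mul0r.
rewrite big_ord_recl mul0r add0r big_ord_recl /= mulr1n subSS subn0.
rewrite big1 ?addr0 => [|i _]; last by rewrite mul0r.
rewrite /expT -scaler_nat scalerA factS natrM invfM mulrA mulfV ?natr_neq0 //.
by rewrite mul1r -scalerAr -exprS.
Qed.

Definition harmonicQ : nat -> {poly R} :=
  fps_mul (fun i => (invA i)%:P) (expT R).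
Local Notation Q := harmonicQ.

Lemma theta_harmonicQ : fps_theta Q =
  fps_mul (fun n => 'X *+ (n == 1%N) - (zeta_signed n)%:P) Q.
Proof.
rewrite /Q fps_theta_mul fps_mulDl.
have -> : fps_theta (fun i => (invA i)%:P) =
    fps_mul (fun n => - (zeta_signed n)%:P) (fun i => (invA i)%:P).
  have -> : (fun n => - (zeta_signed n)%:P) = fun n => (- zeta_signed n)%:P.
    by apply/funext => n; rewrite polyCN.
  rewrite (fps_mul_map polyC) -theta_invA; apply/funext => n.
  by rewrite /fps_theta -[RHS]/((invA n *+ n)%:P) polyCMn.
rewrite theta_expT (fps_mulA (fun i => (invA i)%:P)).
rewrite (fps_mulC (fun i => (invA i)%:P) (fun n => 'X *+ _)) -!fps_mulA.
by apply/funext => n; rewrite addrC.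
Qed.

(** Power sums of 1, ..., 1/m with alternating signs: the coefficients of theta of the logarithm of
    the product of the 1 + u/i. *)
Definition newton_sums (m i : nat) : R :=
  if i is 0 then 0 else - (-1) ^+ i * zN [:: i] m.

Lemma newton_esymN m :
  fps_theta (fun j => e j m) = fps_mul (newton_sums m) (fun j => e j m).
Proof.
elim: m => [|m IH].
  have p0 : newton_sums 0 = fun=> 0.
    by apply/funext => -[//|i]; rewrite /newton_sums zN_cons0 mulr0.
  rewrite p0; apply/funext => n; rewrite /fps_mul big1 => [|i _].
    by rewrite /fps_theta esymN_0; case: n => [|n]; rewrite ?mulr0n ?mul0rn.
  by rewrite mul0r.
set x : R := m.+1%:R^-1.
(* L is the new factor 1 + x u, and r below is its logarithmic derivative x u / (1 + x u). *)
pose L := fun i : nat => if i is i'.+1 then x *+ (i' == 0%N) else 1.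
have LM (a : nat -> R) n : fps_mul L a n.+1 = a n.+1 + x * a n.
  rewrite /fps_mul big_ord_recl mul1r subn0; congr (_ + _).
  rewrite big_ord_recl /= mulr1n subSS subn0 big1 ?addr0 // => i _.
  by rewrite /= mulr0n mul0r.
have LM0 (a : nat -> R) : fps_mul L a 0%N = a 0%N.
  by rewrite /fps_mul big_ord1 mul1r.
have eL : (fun j => e j m.+1) = fps_mul L (fun j => e j m).
  apply/funext => -[|j]; first by rewrite LM0 !esymN0.
  by rewrite LM esymNS [x * _]mulrC.
pose r := fun i : nat => if i is 0 then 0 else - (- x) ^+ i.
have pS : newton_sums m.+1 = fun i => newton_sums m i + r i.
  apply/funext => -[|i]; first by rewrite /= addr0.
  rewrite /newton_sums zN_consS mulrDr; congr (_ + _).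
  by rewrite -[zN [::] m]/(1 : R) mul1r /r (exprNn x) exprVn mulNr.
have tL : fps_theta L = fps_mul r L.
  rewrite fps_mulC; apply/funext => -[|[|n]]; rewrite /fps_theta ?LM ?LM0 /=.
  - by rewrite mulr0n.
  - by rewrite mulr1n mulr0 addr0 expr1 opprK.
  - by rewrite mulr0n mul0rn [(- x) ^+ n.+2]exprS mulNr opprK mulrN subrr.
rewrite eL fps_theta_mul IH tL pS fps_mulDl.
apply/funext => n; rewrite addrC fps_mulA (fps_mulC L) -!fps_mulA.
by [].
Qed.

Lemma harmonicQ0 : Q 0 = 1.
Proof. by rewrite /Q /fps_mul big_ord1 invA0 /expT expr0 fact0 invr1 scale1r mulr1. Qed.

(** Both sides obey Newton's recursion, with power sums for e and their limits for Q. The first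
    power sum is H itself, and the others differ from zeta values by small sequences. *)
Lemma esymN_harmonicQ n : small (fun m => e n m - (Q n).[H m]).
Proof.
have [N] := ubnP n; elim: N n => [//|N IH] [|n] nN.
  under eq_fun do rewrite harmonicQ0 hornerC esymN0 subrr; exact: small0.
pose G i : {poly R} := 'X *+ (i == 1%N) - (zeta_signed i)%:P.
have QE m : (Q n.+1).[H m] *+ n.+1 =
    \sum_(i < n.+2) (G i).[H m] * (Q (n.+1 - i)).[H m].
  have /(congr1 (fun f => (f n.+1).[H m])) := theta_harmonicQ.
  rewrite /fps_theta hornerMn => ->; rewrite /fps_mul horner_sum.
  by apply: eq_bigr => i _; rewrite hornerM.
have eE m : e n.+1 m *+ n.+1 =
    \sum_(i < n.+2) newton_sums m i * e (n.+1 - i) m.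
  by have /(congr1 (fun f => f n.+1)) := newton_esymN m.
have G0 m : (G 0%N).[H m] = 0 by rewrite /G mulr0n sub0r hornerN hornerC oppr0.
have GE i : small (fun m => newton_sums m i - (G i).[H m]).
  case: i => [|[|i]].
  - by under eq_fun do rewrite G0 subrr; exact: small0.
  - have E m : newton_sums m 1 - (G 1%N).[H m] = 0.
      by rewrite /G mulr1n subr0 hornerX /newton_sums expr1 opprK mul1r subrr.
    by under eq_fun do rewrite E; exact: small0.
  - have [//|//|_] := @admissible_zN R [:: i.+2].
    move/(smallZ (- (-1) ^+ i.+2)); congr small; apply/funext => m.
    rewrite -mzvE // mulrBr; congr (_ - _).
    by rewrite /G mulr0n sub0r hornerN hornerC /zeta_signed mulNr.
have : small (fun m => (n.+1%:R)^-1 * (e n.+1 m *+ n.+1 - (Q n.+1).[H m] *+ n.+1)).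
  apply: smallZ; under eq_fun do rewrite eE QE -sumrB.
  apply: small_sum => i _.
  have E m : newton_sums m i * e (n.+1 - i) m - (G i).[H m] * (Q (n.+1 - i)).[H m] =
    e (n.+1 - i) m * (newton_sums m i - (G i).[H m]) +
    (G i).[H m] * (e (n.+1 - i) m - (Q (n.+1 - i)).[H m]) by ring.
  under eq_fun do rewrite E.
  (* The term i = 0 vanishes, so only Q of lower index enters and the induction hypothesis
     applies. *)
  case: i {E} => [[|i] /= ilt].
    under eq_fun do rewrite G0 mul0r subrr mulr0 addr0; exact: small0.
  apply: smallD; last by apply/small_mul_poly/IH; lia.
  apply: (@small_mul_zN R _ (nseq (n.+1 - i.+1) 1%N) _ (GE i.+1)).
  by rewrite /is_index all_nseq orbT.
congr small; apply/funext => m.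
by rewrite -mulrnBl mulrnAr -mulrnAl -[X in X * _ = _]mulr_natl mulfV ?mul1r ?natr_neq0.
Qed.

End HarmonicExpansion.

(** * The two regularizations *)

Section BorelTransform.
Variables (R : realType) (V : lmodType R).

(** The linear map sending T^n / n! to B n. With B = e it evaluates an expansion at m; with B = Q it
    carries the shuffle regularization to the harmonic one. *)
Definition borel (B : nat -> V) (p : {poly R}) : V :=
  \sum_(n < size p) (p`_n * (n`!)%:R) *: B n.

Lemma borel_widen B N (p : {poly R}) : (size p <= N)%N ->
  borel B p = \sum_(n < N) (p`_n * (n`!)%:R) *: B n.
Proof.
move=> pN; rewrite /borel (big_ord_widen N (fun n => (p`_n * (n`!)%:R) *: B n)) //.
rewrite big_mkcond; apply: eq_bigr => i _.
by case: ltnP => // pi; rewrite nth_default // mul0r scale0r.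
Qed.

Lemma borel_is_linear B : linear (borel B).
Proof.
move=> a p q; pose N := maxn (size (a *: p + q)) (maxn (size p) (size q)).
rewrite !(@borel_widen B N) ?leq_max ?leqnn ?orbT //.
rewrite scaler_sumr -big_split; apply: eq_bigr => i _ /=.
by rewrite coefD coefZ scalerA -scalerDl mulrDl mulrA.
Qed.

HB.instance Definition _ B :=
  GRing.isLinear.Build R {poly R} V _ (borel B) (borel_is_linear B).

Lemma borel_expT B n : borel B (expT R n) = B n.
Proof.
rewrite /expT linearZ /= (@borel_widen B n.+1) ?size_polyXn //.
rewrite big_ord_recr big1 /= => [|i _]; last first.
  by rewrite coefXn (ltn_eqF (ltn_ord i)) mul0r scale0r.
by rewrite add0r coefXn eqxx mul1r scalerA mulVf ?scale1r // natr_neq0 ?fact_gt0.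
Qed.

End BorelTransform.

Section Regularizations.
Variable R : realType.
Local Notation zN := (@zN R).
Local Notation e := (@esymN R).
Local Notation H := (@esymN R 1).
Local Notation Q := (@harmonicQ R).
Local Notation E := (@expT R).
Local Notation D := (@zeta_coefs R).

Definition reg_sh (k : seq nat) : {poly R} := \sum_(j < size (D k)) (D k)`_j *: E j.

Definition reg_st (k : seq nat) : {poly R} := \sum_(j < size (D k)) (D k)`_j *: Q j.

Definition esymN_of (p : {poly R}) (m : nat) : R^o :=
  borel (fun j => e j m : R^o) p.

Lemma esymN_ofB p q m : esymN_of (p - q) m = esymN_of p m - esymN_of q m.
Proof. exact: linearB. Qed.

Lemma esymN_of_sum I (s : seq I) (p : I -> {poly R}) m :
  esymN_of (\sum_(i <- s) p i) m = \sum_(i <- s) esymN_of (p i) m.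
Proof. exact: linear_sum. Qed.

Lemma esymN_of_harmonicQ p :
  small (fun m => esymN_of p m - (borel Q p).[H m]).
Proof.
have EE m : esymN_of p m - (borel Q p).[H m] =
    \sum_(n <- iota 0 (size p)) (p`_n * n`!%:R) * (e n m - (Q n).[H m]).
  rewrite /esymN_of /borel horner_sum -sumrB.
  rewrite (_ : iota 0 _ = index_iota 0 (size p)) ?big_mkord; last first.
    by rewrite /index_iota subn0.
  by apply: eq_bigr => i _; rewrite hornerZ mulrBr.
under eq_fun do rewrite EE; apply: small_sum => i _.
exact/smallZ/esymN_harmonicQ.
Qed.

Lemma coef_harmonicQ_gt n N : (n < N)%N -> (Q n)`_N = 0.
Proof.
move=> nN; rewrite /Q /fps_mul coef_sum big1 // => i _.
rewrite coefCM /expT coefZ coefXn [N == _]gtn_eqF ?mulr0 //.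
by rewrite (leq_ltn_trans (leq_subr _ _)).
Qed.

Lemma coef_harmonicQ n : (Q n)`_n = (n`!%:R)^-1.
Proof.
rewrite /Q /fps_mul coef_sum big_ord_recl big1 ?addr0 => [|i _].
  by rewrite coefCM subn0 /expT coefZ coefXn eqxx mulr1 invA0 mul1r.
rewrite coefCM /expT coefZ coefXn lift0 [n == _]gtn_eqF ?mulr0 //.
by have := ltn_ord i; lia.
Qed.

(** Q_n has degree n and leading coefficient 1 / n!, so the map preserves leading coefficients. *)
Lemma borel_harmonicQ_eq0 p : borel Q p = 0 -> p = 0.
Proof.
move=> bp; apply/eqP; apply: contra_eqT bp => p0.
apply/eqP => /(congr1 (fun q : {poly R} => q`_(size p).-1)).
have sp : (0 < size p)%N by rewrite lt0n size_poly_eq0.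
rewrite (@borel_widen _ _ _ (size p).-1.+1); last by rewrite prednK.
rewrite coef_sum coef0.
rewrite big_ord_recr big1 /= ?add0r => [|i _]; last first.
  by rewrite coefZ coef_harmonicQ_gt ?mulr0.
rewrite coefZ coef_harmonicQ mulfK ?natr_neq0 ?fact_gt0 // => /eqP.
by rewrite -[_`_ _]/(lead_coef p) lead_coef_eq0 (negPf p0).
Qed.

Lemma small_esymN_of_eq0 p : small (esymN_of p) -> p = 0.
Proof.
move=> sp; apply: borel_harmonicQ_eq0; apply: small_poly_eq0.
have := smallB sp (esymN_of_harmonicQ p).
by congr small; apply/funext => m; rewrite opprB addrC subrK.
Qed.

Lemma esymN_of_reg_sh k m :
  esymN_of (reg_sh k) m = \sum_(j < size (D k)) (D k)`_j * e j m.
Proof.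
rewrite /esymN_of /reg_sh linear_sum; apply: eq_bigr => j _.
by rewrite linearZ /= borel_expT.
Qed.

Lemma borel_reg_sh k : borel Q (reg_sh k) = reg_st k.
Proof.
rewrite /reg_sh linear_sum; apply: eq_bigr => j _.
by rewrite linearZ /= borel_expT.
Qed.

Lemma reg_sh_small k : is_index k ->
  small (fun m => zN k m - esymN_of (reg_sh k) m).
Proof.
by move=> ik; under eq_fun do rewrite esymN_of_reg_sh; exact: zeta_coefs_small.
Qed.

Lemma reg_st_small k : is_index k -> small (fun m => zN k m - (reg_st k).[H m]).
Proof.
move=> ik; have := smallD (reg_sh_small ik) (esymN_of_harmonicQ (reg_sh k)).
by congr small; apply/funext => m; rewrite borel_reg_sh addrA subrK.
Qed.

(** At T = H both sides agree with the truncated sums up to small errors, and these multiply exactly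
    by [stuffle_zN]. *)
Lemma reg_st_mul k l : is_index k -> is_index l ->
  reg_st k * reg_st l = \sum_(m <- stuffle k l) reg_st m.
Proof.
move=> ik il; apply/eqP; rewrite -subr_eq0; apply/eqP.
apply: small_poly_eq0.
have EE M : (reg_st k * reg_st l - \sum_(m <- stuffle k l) reg_st m).[H M] =
    \sum_(m <- stuffle k l) (zN m M - (reg_st m).[H M]) -
    ((reg_st l).[H M] * (zN k M - (reg_st k).[H M]) +
     zN k M * (zN l M - (reg_st l).[H M])).
  rewrite sumrB -stuffle_zN hornerD hornerM hornerN [X in _ - X = _]horner_sum; ring.
under eq_fun do rewrite EE; apply: smallB.
  apply: small_sum => m mi; apply: reg_st_small.
  exact: (allP (is_index_stuffle ik il)).
apply: smallD; first exact/small_mul_poly/reg_st_small.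
exact/small_mul_zN/reg_st_small.
Qed.

(** The coefficients of (-log(1 - z))^j / j!, the polylogarithm of j ones. *)
Definition coef1 (j : nat) : nat -> R := coefN R (nseq j 1%N).

Lemma coef1S j n : coef1 j.+1 n.+1 = e j n / n.+1%:R.
Proof. by rewrite /coef1 /= expr1. Qed.

Lemma theta_coef1 j : fps_theta (coef1 j.+1) = fps_strict_sums (coef1 j).
Proof.
apply/funext => -[|n]; rewrite /fps_theta fps_strict_sumsE.
  by rewrite big_ord0 mulr0n.
by rewrite coef1S sum_coefN -[LHS]mulr_natr divfK ?natr_neq0.
Qed.

(** Under [fps_theta] the product rule lowers i or j by one, and Pascal's rule adds the two binomial
    coefficients. *)
Lemma coef1_mul i j :
  fps_mul (coef1 i) (coef1 j) = fun n => coef1 (i + j) n *+ 'C(i + j, i).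
Proof.
elim: i j => [|i IHi] j.
  by rewrite [coef1 0](_ : _ = fps_one R) // fps_mul1; apply/funext => n; rewrite bin0.
elim: j => [|j IHj].
  rewrite fps_mulC [coef1 0](_ : _ = fps_one R) // fps_mul1 addn0.
  by apply/funext => n; rewrite binn.
apply: fps_theta_inj.
  by rewrite /fps_mul big_ord1 mul0r mul0rn.
rewrite fps_theta_mul !theta_coef1.
have S1 (a b : nat -> R) :
    fps_mul (fps_strict_sums a) b = fps_strict_sums (fps_mul a b).
  by rewrite /fps_strict_sums fps_mulA.
have S2 (a b : nat -> R) :
    fps_mul a (fps_strict_sums b) = fps_strict_sums (fps_mul a b).
  by rewrite fps_mulC S1 (fps_mulC b).
have S3 (a : nat -> R) c n :
    fps_strict_sums (fun n => a n *+ c) n = fps_strict_sums a n *+ c.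
  by rewrite !fps_strict_sumsE -sumrMnl.
rewrite S1 S2 IHi IHj; apply/funext => n.
rewrite !S3 /fps_theta mulrnAC -/(fps_theta (coef1 (i.+1 + j.+1)) n).
rewrite [(i.+1 + j.+1)%N]addSn theta_coef1 [(i.+1 + j)%N]addSnnS.
by rewrite -mulrnDr binS [('C(_, i) + _)%N]addnC.
Qed.

Lemma esymN_sum_coef1 j : (fun m => e j m) = fps_mul (fun=> 1) (coef1 j).
Proof.
apply/funext => m; rewrite -[LHS]sum_coefN fps_mulC.
by apply: eq_bigr => i _; rewrite mulr1.
Qed.

Lemma zN_fps_mul k : zN k = fps_mul (fun=> 1) (coefN R k).
Proof.
apply/funext => m; rewrite -sum_coefN fps_mulC.
by apply: eq_bigr => i _; rewrite mulr1.
Qed.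

(* |s| <= C e_l(n) / (n + 1) = C coef1 l.+1 n.+1, so the exact formula
   coef1_mul bounds the convolution. *)
Lemma small_fps_mul j (c s : nat -> R) : (forall n, `|c n| <= coef1 j n) ->
  small s -> small (fps_mul c s).
Proof.
move=> cj [C [J [C0 sC]]].
exists (C * \sum_(l < J) 'C(j + l.+1, j)%:R), (j + J)%N; split.
  by rewrite mulr_ge0 // sumr_ge0.
move=> N; apply: (le_trans (ler_norm_sum _ _ _)).
apply: (@le_trans _ _ (C * \sum_(l < J) fps_mul (coef1 j) (coef1 l.+1) N.+1)).
  rewrite mulr_sumr /fps_mul.
  under [leRHS]eq_bigr do rewrite big_ord_recr /= subnn mulr0 addr0 mulr_sumr.
  rewrite exchange_big /=; apply: ler_sum => i _; rewrite normrM.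
  apply: (@le_trans _ _ (coef1 j i * (C * (esymN_sums R J (N - i) / (N - i).+1%:R)))).
    by rewrite ler_pM.
  rewrite mulrCA /esymN_sums mulr_suml !mulr_sumr le_eqVlt; apply/orP; left.
  apply/eqP/eq_bigr => l _; rewrite subSn ?coef1S //; last by rewrite -ltnS.
rewrite -mulrA ler_wpM2l // mulr_suml; apply: ler_sum => l _.
rewrite coef1_mul addnS coef1S -[leLHS]mulr_natl ler_wpM2l //.
rewrite ler_wpM2r ?invr_ge0 //; apply: esymN_le_sums.
by rewrite ltn_add2l.
Qed.

Lemma coefN_le_coef1 k n : is_index k -> `|coefN R k n| <= coef1 (size k) n.
Proof.
move=> ik; rewrite ger0_norm ?coefN_ge0 //.
case: k n ik => [|a k] [|n] //= /andP[a0 ik]; rewrite coef1S.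
rewrite ler_pM ?zN_ge0 ?invr_ge0 ?exprn_ge0 ?zN_le_esymN //.
by rewrite lef_pV2 ?qualifE/= ?exprn_gt0 ?ltr0n // ler_eXnr ?ler1n.
Qed.

Lemma fps_mul_lincombl n (a : 'I_n -> R) (F : 'I_n -> nat -> R) b m :
  fps_mul (fun m => \sum_i a i * F i m) b m = \sum_i a i * fps_mul (F i) b m.
Proof.
rewrite /fps_mul; under eq_bigr do rewrite mulr_suml.
rewrite exchange_big; apply: eq_bigr => i _ /=.
by rewrite mulr_sumr; apply: eq_bigr => j _; rewrite mulrA.
Qed.

Lemma fps_mul_lincombr n (a : 'I_n -> R) (F : 'I_n -> nat -> R) b m :
  fps_mul b (fun m => \sum_i a i * F i m) m = \sum_i a i * fps_mul b (F i) m.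
Proof.
rewrite fps_mulC fps_mul_lincombl.
by apply: eq_bigr => i _; rewrite fps_mulC.
Qed.

Lemma fps_mulB_l (a b c : nat -> R) m :
  fps_mul (fun n => a n - b n) c m = fps_mul a c m - fps_mul b c m.
Proof. by rewrite fps_mulDl fps_mulNl. Qed.

Definition coef_reg (k : seq nat) (n : nat) : R :=
  \sum_(j < size (D k)) (D k)`_j * coef1 j n.

Lemma esymN_of_reg_sh_fps k :
  esymN_of (reg_sh k) = fps_mul (fun=> 1) (coef_reg k).
Proof.
apply/funext => m; rewrite esymN_of_reg_sh /coef_reg fps_mul_lincombr.
by apply: eq_bigr => j _; rewrite -esymN_sum_coef1.
Qed.

Lemma expT_mul i j : E i * E j = E (i + j) *+ 'C(i + j, i).
Proof.
rewrite /E -scalerAl -scalerAr -exprD scalerA -[RHS]scaler_nat [RHS]scalerA.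
congr (_ *: _); rewrite -(bin_fact (leq_addr j i)) addKn !natrM.
field; rewrite !natr_neq0 ?fact_gt0 ?bin_gt0 ?leq_addr //.
Qed.

(** The T^j / j! under multiplication and the [coef1 j] under Cauchy product have the same binomial
    structure constants. *)
Lemma esymN_of_reg_sh_mul k l m : esymN_of (reg_sh k * reg_sh l) m =
  fps_mul (coef_reg k) (esymN_of (reg_sh l)) m.
Proof.
have -> : esymN_of (reg_sh l) = fun m => \sum_(j < size (D l)) (D l)`_j * e j m.
  by apply/funext => m'; exact: esymN_of_reg_sh.
rewrite fps_mul_lincombl /esymN_of mulr_suml linear_sum; apply: eq_bigr => i _.
rewrite -scalerAl linearZ mulr_sumr linear_sum; congr (_ * _).
rewrite fps_mul_lincombr; apply: eq_bigr => j _.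
rewrite -scalerAr linearZ expT_mul linearMn /= borel_expT; congr (_ * _).
rewrite esymN_sum_coef1 fps_mulA (fps_mulC (coef1 i)) -fps_mulA coef1_mul.
rewrite {1}/fps_mul; under eq_bigr do rewrite mulrnAr.
rewrite sumrMnl; congr (_ *+ _).
by have /(congr1 (fun f => f m)) := esymN_sum_coef1 (i + j) => ->.
Qed.

(** Here the exact rule is the Cauchy product of the [coefN], whose partial sums are the zN;
    [small_fps_mul] keeps the errors small under this product. *)
Lemma reg_sh_mul k l : is_index k -> is_index l ->
  reg_sh k * reg_sh l = \sum_(m <- shuffle k l) reg_sh m.
Proof.
move=> ik il; apply/eqP; rewrite -subr_eq0; apply/eqP.
apply: small_esymN_of_eq0.
pose s k m := zN k m - esymN_of (reg_sh k) m.
have zM M : \sum_(m <- shuffle k l) zN m M = fps_mul (zN k) (coefN R l) M.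
  rewrite zN_fps_mul -fps_mulA coefN_shuffle // fps_mul_sum.
  by apply: eq_bigr => m _; rewrite zN_fps_mul.
(* The expansion replaces k first and l second; the factor 1 / (1 - z) that forms partial sums may
   be moved from one series to the other. *)
have EE M : esymN_of (reg_sh k * reg_sh l - \sum_(m <- shuffle k l) reg_sh m) M =
    \sum_(m <- shuffle k l) s m M -
    (fps_mul (coefN R l) (s k) M + fps_mul (coef_reg k) (s l) M).
  rewrite esymN_ofB esymN_of_sum esymN_of_reg_sh_mul /s.
  rewrite sumrB zM !(fps_mulC _ (fun m => _ - _)) !fps_mulB_l.
  rewrite (fps_mulC (esymN_of (reg_sh l))).
  rewrite (_ : fps_mul (zN l) _ = fps_mul (esymN_of (reg_sh k)) (coefN R l)).
    rewrite /esymN_of; ring.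
  by rewrite esymN_of_reg_sh_fps zN_fps_mul -!fps_mulA (fps_mulC (coefN R l)).
rewrite (funext EE); apply: smallB.
  apply: small_sum => m mi; apply: reg_sh_small.
  exact: (allP (is_index_shuffle k l)).
apply: smallD.
  apply: (small_fps_mul (j := size l)); last exact: reg_sh_small.
  by move=> n; exact: coefN_le_coef1.
have EC M : fps_mul (coef_reg k) (s l) M =
    \sum_(j <- index_enum 'I_(size (D k))) (D k)`_j * fps_mul (coef1 j) (s l) M.
  by rewrite /coef_reg fps_mul_lincombl.
rewrite (funext EC); apply: small_sum => j _; apply: smallZ.
apply: (small_fps_mul (j := j)); last exact: reg_sh_small.
by move=> n; rewrite ger0_norm // coefN_ge0.
Qed.

Lemma zeta_coefs_admissible k : is_index k -> admissible k ->
  D k = [:: mzv R k].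
Proof.
move=> ik ak; rewrite mzvE //; case: k ik ak => [|a k] ik ak /=.
  by congr (_ :: _); apply/esym; exact: lim_cst.
rewrite (gtn_eqF ak); congr (_ :: _); congr (limn _).
by apply/funext => m; rewrite big_ord0 subr0.
Qed.

Lemma zeta_coefs_one : D [:: 1%N] = [:: 0; 1].
Proof.
rewrite /=; congr (_ :: _).
have -> : (fun m => zN [:: 1%N] m - \sum_(j < 1) [:: 1]`_j * e j.+1 m) = fun=> 0.
  by apply/funext => m; rewrite big_ord1 mul1r subrr.
exact: lim_cst.
Qed.

Lemma harmonicQ1 : Q 1 = 'X.
Proof.
have /(congr1 (fun f => f 1%N)) := @theta_harmonicQ R.
rewrite /fps_theta mulr1n => ->; rewrite /fps_mul !big_ord_recl big_ord0.
by rewrite /= /zeta_signed /= harmonicQ0 !subr0 mulr0n mul0r add0r mulr1 addr0.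
Qed.

Lemma reg_st_regularization : is_regularization stuffle reg_st.
Proof.
split=> [k ik ak||]; last exact: reg_st_mul.
  by rewrite /reg_st zeta_coefs_admissible // big_ord1 /= harmonicQ0 alg_polyC.
by rewrite /reg_st zeta_coefs_one !big_ord_recl big_ord0 /= scale0r add0r addr0
  scale1r harmonicQ1.
Qed.

Lemma reg_sh_regularization : is_regularization shuffle reg_sh.
Proof.
split=> [k ik ak||]; last exact: reg_sh_mul.
  rewrite /reg_sh zeta_coefs_admissible // big_ord1 /= /E fact0 invr1 scale1r.
  by rewrite expr0 alg_polyC.
by rewrite /reg_sh zeta_coefs_one !big_ord_recl big_ord0 /= scale0r add0r addr0
  scale1r /E factS fact0 muln1 invr1 scale1r expr1.
Qed.

(** Existence ensures that [xget] returns a true regularization, and uniqueness identifies it on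
    indices. *)
Lemma zeta_stE k : is_index k -> zeta_st R k = reg_st k.
Proof.
move=> ik.
apply: (regularization_unique stuffle_triangular _ reg_st_regularization) => //.
exact: (xgetI (fun=> 0) reg_st_regularization).
Qed.

Lemma zeta_shE k : is_index k -> zeta_sh R k = reg_sh k.
Proof.
move=> ik.
apply: (regularization_unique shuffle_triangular _ reg_sh_regularization) => //.
exact: (xgetI (fun=> 0) reg_sh_regularization).
Qed.

End Regularizations.

(** * Cuts of an index and rescaled series *)

Section Cuts.
Variables (R : realType) (K : fieldType) (iota : {rmorphism R -> K}) (x y : K).
Local Notation D := (@zeta_coefs R).

(** Reduces every coefficient to a constant term, so that the two sides of a cut contribute only
    through a run of ones around it. *)
Lemma nth_zeta_coefs k j : (j <= size k)%N ->
  (D k)`_j = if take j k == nseq j 1%N then (D (drop j k))`_0 else 0.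
Proof.
elim: k j => [|a k IH] [|j] //= jk; rewrite eqseq_cons.
by have [_|_] := eqVneq a 1%N; [exact: IH|rewrite nth_nil].
Qed.

Lemma size_zeta_coefs k : (size (D k) <= (size k).+1)%N.
Proof. by elim: k => [//|a k IH] /=; case: ifP. Qed.

Lemma sum_zeta_coefs (V : nmodType) (F : nat -> R -> V) k :
  (forall j, F j 0 = 0) ->
  \sum_(j < size (D k)) F j (D k)`_j = \sum_(j < (size k).+1) F j (D k)`_j.
Proof.
move=> F0; rewrite (big_ord_widen _ (fun j => F j (D k)`_j) (size_zeta_coefs k)).
rewrite big_mkcond; apply: eq_bigr => j _.
by case: ltnP => // ?; rewrite nth_default.
Qed.

(** Here and in [sum_sub_right], lengths j and l counted from the cut i become positions a = i - j
    and b = i + l in the whole index. *)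
Lemma sum_sub_left (V : nmodType) (g : nat -> V) i r : (i <= r)%N ->
  \sum_(j < i.+1) g j = \sum_(a < r.+1 | (a <= i)%N) g (i - a)%N.
Proof.
move=> ir; rewrite (reindex_inj rev_ord_inj) /=.
rewrite (big_ord_widen r.+1 (fun a => g (i.+1 - a.+1)%N)) //.
Qed.

Lemma sum_sub_right (V : nmodType) (g : nat -> V) i r : (i <= r)%N ->
  \sum_(l < (r - i).+1) g l = \sum_(b < r.+1 | (i <= b)%N) g (b - i)%N.
Proof.
move=> ir; rewrite -subSn // -(big_mkord xpredT g).
rewrite -(big_mkord (fun b => i <= b)%N (fun b => g (b - i)%N)).
transitivity (\sum_(i <= b < r.+1) g (b - i)%N).
  by rewrite -{2}[i]add0n big_addn; apply: eq_bigr => l _; rewrite addnK.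
by rewrite (big_nat_widenl i 0).
Qed.

Variable B : nat -> {poly K}.

Definition zeta_comb (k : seq nat) : {poly K} :=
  \sum_(j < size (D k)) iota (D k)`_j *: B j.

(* The weight of a run of ones k_(a+1), ..., k_b of k, with the constant
   terms of its two sides. *)
Definition run_weight (k : seq nat) (a b : nat) : K :=
  if take (b - a) (drop a k) == nseq (b - a) 1%N then
    x ^+ sumn (take a k) * y ^+ sumn (drop b k) *
    (iota (D (rev (take a k)))`_0 * iota (D (drop b k))`_0)
  else 0.

Lemma zeta_combE k : zeta_comb k = \sum_(j < (size k).+1) iota (D k)`_j *: B j.
Proof.
rewrite /zeta_comb (@sum_zeta_coefs _ (fun j c => iota c *: B j)) // => j.
by rewrite rmorph0 scale0r.
Qed.

Lemma cut_cat (l p s t : seq nat) :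
  x ^+ sumn (l ++ p) * y ^+ sumn (s ++ t) *
  (iota (D (rev (l ++ p)))`_(size p) * iota (D (s ++ t))`_(size s)) =
  if p ++ s == nseq (size p + size s) 1%N then
    x ^+ sumn l * y ^+ sumn t * (iota (D (rev l))`_0 * iota (D t)`_0) *
    (x ^+ size p * y ^+ size s)
  else 0.
Proof.
rewrite (@nth_zeta_coefs (rev (l ++ p))) ?size_rev ?size_cat ?leq_addl //.
rewrite (@nth_zeta_coefs (s ++ t) (size s)) ?size_cat ?leq_addr //.
rewrite rev_cat take_size_cat ?size_rev // drop_size_cat ?size_rev //.
rewrite take_size_cat // drop_size_cat // nseqD eqseq_cat ?size_nseq //.
rewrite -{1}(rev_nseq (size p)) (inj_eq (can_inj revK)).
have [pE|_] := eqVneq p; last by rewrite rmorph0 mul0r mulr0.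
have [sE|_] := eqVneq s; last by rewrite rmorph0 !mulr0.
have sumE q : q = nseq (size q) 1%N -> sumn q = size q.
  by move=> qE; rewrite {1}qE sumn_nseq mul1n.
by rewrite !sumn_cat !exprD (sumE p pE) (sumE s sE); ring.
Qed.

(** Once the run from a to b is fixed, the place i of the cut only enters through powers of x and y,
    because entries equal to 1 contribute their number to the weight. *)
Lemma cut_run_weight k a i b : (a <= i)%N -> (i <= b)%N -> (b <= size k)%N ->
  x ^+ sumn (take i k) * y ^+ sumn (drop i k) *
  (iota (D (rev (take i k)))`_(i - a) * iota (D (drop i k))`_(b - i)) =
  run_weight k a b * (x ^+ (i - a) * y ^+ (b - i)).
Proof.
move=> ai ib bk; have ik := leq_trans ib bk.
pose p := drop a (take i k); pose s := take (b - i) (drop i k).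
have sp : size p = (i - a)%N by rewrite size_drop size_takel.
have ss : size s = (b - i)%N by rewrite size_takel // size_drop leq_sub2r.
have iE : take i k = take a k ++ p.
  by rewrite -{1}(cat_take_drop a (take i k)) take_takel.
have dE : drop i k = s ++ drop b k.
  by rewrite -{1}(cat_take_drop (b - i) (drop i k)) drop_drop subnK.
have psE : take (b - a) (drop a k) = p ++ s.
  rewrite take_drop subnK ?(leq_trans ai) // -{1}(subnKC ib) takeD iE -catA.
  by rewrite drop_size_cat // size_takel // (leq_trans ai).
rewrite /run_weight psE -(subnKC (leq_sub2r a ib)).
have -> : (b - a - (i - a) = b - i)%N by lia.
rewrite -sp -ss {1 2}iE {1 2}dE cut_cat.
by case: ifP => //; rewrite mul0r.
Qed.

(* The coefficient of u^n in f(x u) f(y u), for the series f of the B j. *)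
Definition conv_xy (n : nat) : {poly K} :=
  fps_mul (fps_scale x%:P B) (fps_scale y%:P B) n.

(** Expanding both factors and summing over the cut last gives a convolution for each run. Since B
    is arbitrary, the same weights serve both regularizations. *)
Lemma sum_cuts_zeta_comb k :
  \sum_(i < (size k).+1) (x ^+ sumn (take i k) * y ^+ sumn (drop i k)) *:
    (zeta_comb (rev (take i k)) * zeta_comb (drop i k)) =
  \sum_(a < (size k).+1) \sum_(b < (size k).+1 | (a <= b)%N)
    run_weight k a b *: conv_xy (b - a).
Proof.
set r := size k.
pose T a i b := run_weight k a b *:
  ((x ^+ (i - a) * y ^+ (b - i)) *: (B (i - a) * B (b - i))).
transitivity (\sum_(i < r.+1) \sum_(a < r.+1 | (a <= i)%N)
    \sum_(b < r.+1 | (i <= b)%N) T a i b).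
  apply: eq_bigr => i _; have ir : (i <= r)%N by rewrite -ltnS.
  rewrite !zeta_combE size_rev size_takel // size_drop -/r.
  rewrite (sum_sub_left (fun j => iota (D (rev (take i k)))`_j *: B j) ir).
  rewrite (sum_sub_right (fun j => iota (D (drop i k))`_j *: B j) ir).
  rewrite mulr_suml scaler_sumr; apply: eq_bigr => a ai.
  rewrite mulr_sumr scaler_sumr; apply: eq_bigr => b ib.
  rewrite -scalerAl -scalerAr !scalerA /T scalerA -cut_run_weight //.
    by rewrite mulrA.
  by rewrite -ltnS.
rewrite (exchange_big_dep xpredT) //=; apply: eq_bigr => a _.
rewrite (exchange_big_dep (fun b : 'I_r.+1 => a <= b)%N) /=; last first.
  by move=> i b; apply: leq_trans.
apply: eq_bigr => b ab; rewrite -scaler_sumr; congr (_ *: _).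
pose g j := fps_scale x%:P B j * fps_scale y%:P B (b - a - j)%N.
rewrite /conv_xy /fps_mul (sum_sub_right g ab).
have br : (b <= r)%N by rewrite -ltnS.
rewrite (big_ord_widen_cond r.+1 (fun i => a <= i)%N (fun i => g (i - a)%N)) //.
apply: eq_big => [i|i /andP[ai ib]]; first by rewrite ltnS.
rewrite /g /fps_scale (_ : b - a - (i - a) = b - i)%N; last by lia.
rewrite -!polyC_exp mulrACA -polyCM mul_polyC //.
Qed.

End Cuts.

(** Logarithmic derivatives add under products. *)
Lemma fps_theta_mul_log (A : comNzRingType) (p q a b : nat -> A) :
  fps_theta a = fps_mul p a -> fps_theta b = fps_mul q b ->
  fps_theta (fps_mul a b) = fps_mul (fun n => p n + q n) (fps_mul a b).
Proof.
move=> ta tb; rewrite fps_theta_mul ta tb fps_mulDl -fps_mulA.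
by rewrite (fps_mulA a q b) (fps_mulC a q) -fps_mulA.
Qed.

(** * Rescaled generating series and the action of rho *)

Section Rescaling.
Variables (R : realType) (K : fieldType) (iota : {rmorphism R -> K}) (x y : K).
Hypothesis K0 : forall n, (0 < n)%N -> n%:R != 0 :> K.
Hypothesis xy0 : x + y != 0.

(** The form of [A_exponent] over a general field K; at R(x, y) with [constK] the two agree by
    conversion. *)
Definition exponent (n : nat) : K :=
  if (n < 2)%N then 0
  else (-1) ^+ n / n%:R * iota (mzv R [:: n]) * ((x ^+ n + y ^+ n) / (x + y) ^+ n).

Local Notation A := (fps_exp exponent).
Local Notation expK := (expT K).

Lemma fps_scale_expK : fps_mul (fps_scale x%:P expK) (fps_scale y%:P expK) =
  fps_scale (x + y)%:P expK.
Proof.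
apply/funext => n; rewrite /fps_mul /fps_scale -polyC_exp [x + y]addrC exprDn.
rewrite rmorph_sum /= mulr_suml; apply: eq_bigr => i _.
have ni : (i <= n)%N by rewrite -ltnS.
rewrite -!polyC_exp !mul_polyC /expK !scalerA -scalerAl -scalerAr scalerA -exprD.
rewrite subnKC //; congr (_ *: _).
rewrite -(bin_fact ni) !natrM -mulr_natr.
have := K0 (fact_gt0 i); have := K0 (fact_gt0 (n - i)).
have : ('C(n, i))%:R != 0 :> K by rewrite K0 // bin_gt0.
by move=> h1 h2 h3; field; rewrite h1 h2 h3.
Qed.

Lemma fps_scale_polyC (c : K) (a : nat -> K) :
  fps_scale c%:P (fun n => (a n)%:P) = fun n => (fps_scale c a n)%:P.
Proof. by apply/funext => n; rewrite /fps_scale polyCM polyC_exp. Qed.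

Lemma theta_iota_invA : fps_theta (fun n => iota (invA R n)) =
  fps_mul (fun n => - iota (zeta_signed R n)) (fun n => iota (invA R n)).
Proof.
have -> : (fun n => - iota (zeta_signed R n)) = fun n => iota (- zeta_signed R n).
  by apply/funext => n; rewrite rmorphN.
rewrite (fps_mul_map iota) -theta_invA; apply/funext => n.
by rewrite /fps_theta rmorphMn.
Qed.

(* A_{x,y}((x + y) u) = A(x u) A(y u), as the exponents agree. *)
Lemma rescaled_exponents :
  fps_mul (fps_mul (fps_scale x (fun n => iota (invA R n)))
                   (fps_scale y (fun n => iota (invA R n))))
    (fps_scale (x + y) A) = fps_one K.
Proof.
apply: (fps_theta_eq0 K0).
  by rewrite /fps_mul !big_ord1 /fps_scale !expr0 !mul1r invA0 rmorph1 fps_exp0 !mulr1.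
have scale_theta c (p a : nat -> K) : fps_theta a = fps_mul p a ->
    fps_theta (fps_scale c a) = fps_mul (fps_scale c p) (fps_scale c a).
  by move=> E; rewrite fps_theta_scale E fps_scale_mul.
have tx := scale_theta x _ _ theta_iota_invA.
have ty := scale_theta y _ _ theta_iota_invA.
have ts := scale_theta (x + y) _ _ (fps_theta_exp K0 (erefl : exponent 0 = 0)).
rewrite (fps_theta_mul_log (fps_theta_mul_log tx ty) ts).
set p := fun n => _ + _; have -> : p = fun=> 0.
  apply/funext => n; rewrite /p /fps_scale /fps_theta /zeta_signed /exponent.
  case: ifP => n2; first by rewrite mul0rn rmorph0 oppr0 !mulr0 !addr0.
  have n0 : n%:R != 0 :> K by rewrite K0 //; lia.
  have sn0 : (x + y) ^+ n != 0 by rewrite expf_neq0.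
  rewrite rmorphM rmorphXn rmorphN1 -[(_ * _) *+ n]mulr_natr.
  by field; rewrite n0 sn0.
by apply/funext => n; rewrite /fps_mul big1 // => i _; rewrite mul0r.
Qed.

(** The left argument is the coefficient of u^n in c(u) e^(T(x+y)u) with c(u) = 1 / (A(xu) A(yu)),
    and rho contributes A_{x,y}((x+y)u), which cancels c. *)
Lemma rho_conv_xy (rho : {linear {poly K} -> {poly K}}) :
    (forall n, rho (expK n) = fps_mul (fun i => (A i)%:P) expK n) ->
  forall n, rho (conv_xy x y (fun j => map_poly iota (harmonicQ R j)) n) =
            conv_xy x y expK n.
Proof.
move=> rhoE n.
have QE : (fun j => map_poly iota (harmonicQ R j)) =
    fps_mul (fun i => (iota (invA R i))%:P) expK.
  rewrite -(fps_mul_map (map_poly iota)); congr fps_mul; apply/funext => i.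
    by rewrite /= map_polyC.
  by rewrite /= /expT map_polyZ map_polyXn fmorphV rmorph_nat.
pose c := fps_mul (fps_scale x (fun i => iota (invA R i)))
                  (fps_scale y (fun i => iota (invA R i))).
have convE : conv_xy x y (fun j => map_poly iota (harmonicQ R j)) =
    fps_mul (fun i => (c i)%:P) (fps_scale (x + y)%:P expK).
  rewrite /conv_xy QE !fps_scale_mul !fps_scale_polyC -fps_scale_expK.
  rewrite -(fps_mul_map polyC) -!fps_mulA; congr fps_mul.
  by rewrite !fps_mulA; congr fps_mul; rewrite fps_mulC.
rewrite convE /fps_mul linear_sum /=.
(* By linearity rho passes the scalars c_i and (x + y)^n, so its rule holds with u replaced by (x +
   y) u. *)
transitivity (fps_mul (fun i => (c i)%:P) (fps_scale (x + y)%:P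
   (fps_mul (fun i => (A i)%:P) expK)) n).
  apply: eq_bigr => i _; rewrite /fps_scale -polyC_exp !mul_polyC 2!linearZ /=.
  by rewrite rhoE.
rewrite fps_scale_mul fps_mulA fps_scale_polyC (fps_mul_map polyC).
rewrite rescaled_exponents -fps_scale_expK.
rewrite (_ : (fun n => (fps_one K n)%:P) = fps_one {poly K}) ?fps_mul1 //.
by apply/funext => i; rewrite /fps_one polyC_natr.
Qed.

End Rescaling.

(** * Specialization to the field of fractions *)

Section FractionField.
Variable R : realType.

Definition constK : {rmorphism R -> Kxy R} :=
  @FracField.tofrac (Rxy R) \o (polyC \o polyC).

Lemma toKxyT_toRxyT (p : {poly R}) : toKxyT (toRxyT p) = map_poly constK p.
Proof.
apply/polyP => i; rewrite /toKxyT /toRxyT.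
rewrite (coef_map (@FracField.tofrac (Rxy R))) (coef_map constK).
by rewrite coef_map_id0 // !polyC0.
Qed.

Lemma toKxyT_zeta_xy (z : seq nat -> {poly R}) k :
  toKxyT (zeta_xy z k) = \sum_(i < (size k).+1)
    (fx R ^+ sumn (take i k) * fy R ^+ sumn (drop i k)) *:
    (map_poly constK (z (rev (take i k))) * map_poly constK (z (drop i k))).
Proof.
rewrite /toKxyT /zeta_xy (rmorph_sum (map_poly (@FracField.tofrac (Rxy R)))).
apply: eq_bigr => i _.
rewrite [LHS](map_polyZ (@FracField.tofrac (Rxy R))) rmorphM !rmorphXn.
rewrite (rmorphM (map_poly (@FracField.tofrac (Rxy R)))).
by rewrite -!toKxyT_toRxyT.
Qed.

Lemma fx_fy_neq0 : fx R + fy R != 0.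
Proof.
rewrite /fx /fy /toKxy -rmorphD tofrac_eq0; apply/eqP.
move=> /(congr1 (fun p : {poly {poly R}} => p`_1)) /eqP.
by rewrite /vx /vy coefD coefC coefX coef0 add0r oner_eq0.
Qed.

Lemma map_reg_sh k : map_poly constK (reg_sh R k) = zeta_comb constK (expT (Kxy R)) k.
Proof.
rewrite /reg_sh rmorph_sum; apply: eq_bigr => j _.
rewrite [LHS](map_polyZ constK); congr (_ *: _).
by rewrite /expT map_polyZ map_polyXn fmorphV rmorph_nat.
Qed.

Lemma map_reg_st k : map_poly constK (reg_st R k) =
  zeta_comb constK (fun j => map_poly constK (harmonicQ R j)) k.
Proof.
by rewrite /reg_st rmorph_sum; apply: eq_bigr => j _; exact: (map_polyZ constK).
Qed.

Lemma is_index_take i k : is_index k -> is_index (take i k).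
Proof. by move=> /allP ik; apply/allP => n /mem_take/ik. Qed.

Lemma is_index_drop i k : is_index k -> is_index (drop i k).
Proof. by move=> /allP ik; apply/allP => n /mem_drop/ik. Qed.

End FractionField.

Theorem theorem1p5 (R : realType) (k : seq nat) (hk : is_index k) :
  toKxyT (zeta_xy (@zeta_sh R) k) = rho_xy (toKxyT (zeta_xy (@zeta_st R) k)).
Proof.
rewrite !toKxyT_zeta_xy.
have iL i : is_index (rev (take i k)) 
  by rewrite /is_index all_rev; exact: is_index_take.
under eq_bigr do rewrite !zeta_shE ?iL ?is_index_drop // !map_reg_sh.
under [in RHS]eq_bigr do rewrite !zeta_stE ?iL ?is_index_drop // !map_reg_st.
(* Both sides are now sums over runs of ones with the same weights, and it remains to compare the
   coefficients [conv_xy]. *)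
rewrite !sum_cuts_zeta_comb linear_sum; apply: eq_bigr => a _.
rewrite linear_sum; apply: eq_bigr => b _; rewrite linearZ; congr (_ *: _).
apply/esym/(rho_conv_xy (@Kxy_natr_neq0 R) (fx_fy_neq0 R)) => n.
exact: rho_xy_expTu.
Qed.
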